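(* Let $\kappa$ be a cumulant function with effective domain $\Theta$ satisfying Assumption (A1), let $\varphi>0$, and let $Y_1,\dots,Y_n$ be independent with $Y_i\sim\mathrm{EDF}(\theta_i,v_i,\varphi,\kappa)$, $v_i>0$, $\theta_i\in\mathring\Theta$, and $\theta_1\le\dots\le\theta_n$. Let $\mathcal J\subseteq\{1,\dots,n\}^2$ be any set of ordered pairs (i.e. $(j,k)\in\mathcal J\Rightarrow j\le k$), write $\mu_i=\mathbb E[Y_i]$, let $1-\alpha\in(0,1)$ and $\delta=\alpha/(2|\mathcal J|)$. Define $$L^\alpha_{\mathbf Y,i}=\sup_{(j,k)\in\mathcal J:\,\theta_i\ge\theta_k}l^\delta(Z_{j:k},v_{j:k},\varphi,\kappa),\qquad U^\alpha_{\mathbf Y,i}=\inf_{(j,k)\in\mathcal J:\,\theta_i\le\theta_j}u^\delta(Z_{j:k},v_{j:k},\varphi,\kappa),$$ with the conventions $\inf\emptyset=\sup_{\theta\in\mathring\Theta}\kappa'(\theta)$ and $\sup\emptyset=\inf_{\theta\in\mathring\Theta}\kappa'(\theta)$. Then $$\mathbb P\big(L^\alpha_{\mathbf Y,i}\le\mu_i\le U^\alpha_{\mathbf Y,i}\ \text{for all } i\in\{1,\dots,n\}\big)\ge1-\alpha.$$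
   Context: A real random variable $Y$ follows $\mathrm{EDF}(\theta,v,\varphi,\kappa)$ if it has density $f(y)=\exp\{(y\theta-\kappa(\theta))/(\varphi/v)+a(y;v/\varphi)\}$ with respect to a $\sigma$-finite measure on $\mathbb R$ not depending on $\theta$; $\Theta$ is the effective domain, $\kappa$ the cumulant function, $v>0$ the volume, $\varphi>0$ the dispersion. Assumption (A1): $\Theta$ has non-empty interior $\mathring{\Theta}$ and the dominating measures are not a single point mass; then $\mathbb E[Y]=\kappa'(\theta)$ for $\theta\in\mathring\Theta$, $h=(\kappa')^{-1}$ on $\kappa'(\mathring\Theta)$. For $\mu\in\kappa'(\mathring\Theta)$, $F(y;h(\mu),v,\varphi,\kappa)=\mathbb P(W\le y)$, $F^*(y;h(\mu),v,\varphi,\kappa)=\mathbb P(W<y)$ with $W\sim\mathrm{EDF}(h(\mu),v,\varphi,\kappa)$; $l^{\delta}(y,v,\varphi,\kappa)=\inf\{\mu\in\kappa'(\mathring\Theta):F^*(y;h(\mu),v,\varphi,\kappa)\le1-\delta\}$ and $u^{\delta}(y,v,\varphi,\kappa)=\sup\{\mu\in\kappa'(\mathring\Theta):F(y;h(\mu),v,\varphi,\kappa)\ge\delta\}$. For $1\le j\le k\le n$: $v_{j:k}=\sum_{i=j}^kv_i$ and $Z_{j:k}=\frac1{v_{j:k}}\sum_{i=j}^kv_iY_i$. *)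

(* Defs.v *)
From HB Require Import structures.
From mathcomp Require Import all_boot all_order all_algebra.
From mathcomp Require Import all_classical all_reals all_analysis.
Set Implicit Arguments. Unset Strict Implicit. Unset Printing Implicit Defensive.
Import Order.TTheory GRing.Theory Num.Theory.
Import numFieldNormedType.Exports.
Local Open Scope classical_set_scope.
Local Open Scope ring_scope.

Section EDF.
Variable R : realType.
Implicit Types (kappa : R -> R) (Theta : set R).

(** [nu] is a dominating measure for the EDF with cumulant function [kappa],
    effective domain [Theta] and weight [w = v/phi]: the term [exp(a(y;w))] of
    the density is absorbed into [nu].  [kappa] is the cumulant function and
    [Theta] its effective domain:
      t \in Theta  <->  int exp(w y t) dnu(y) < +oo,
      and then int exp(w y t) dnu(y) = exp(w kappa(t)). *)
Definition EDF_dom kappa Theta (w : R) (nu : {measure set R -> \bar R}) : Prop :=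
  forall t : R,
    (Theta t <-> (\int[nu]_y (expR (w * y * t))%:E < +oo)%E) /\
    (Theta t -> (\int[nu]_y (expR (w * y * t))%:E)%E = (expR (w * kappa t))%:E).

Definition EDF_law kappa Theta (theta v phi : R) (Q : set R -> \bar R) : Prop :=
  Theta theta /\
  exists nu : {measure set R -> \bar R}, EDF_dom kappa Theta (v / phi) nu /\
    forall A : set R, measurable A ->
      Q A = (\int[nu]_(y in A) (expR ((y * theta - kappa theta) / (phi / v)))%:E)%E.

Definition assumption_A1 kappa Theta : Prop :=
  Theta° !=set0 /\
  forall (w : R) (nu : {measure set R -> \bar R}), 0 < w ->
    EDF_dom kappa Theta w nu -> ~ (exists c : R, nu (~` [set c]) = 0%E).

Definition EDF_lawof kappa Theta theta v phi : set R -> \bar R :=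
  match pselect (exists Q, EDF_law kappa Theta theta v phi Q) with
  | left e => projT1 (cid e)
  | right _ => fun _ => 0%E
  end.

Definition EDF_F kappa Theta theta v phi (y : R) : \bar R :=
  EDF_lawof kappa Theta theta v phi `]-oo, y].
Definition EDF_Fs kappa Theta theta v phi (y : R) : \bar R :=
  EDF_lawof kappa Theta theta v phi `]-oo, y[.

Definition mean_space kappa Theta : set R := derive1 kappa @` Theta°.
Definition EDF_h kappa Theta (mu : R) : R :=
  match pselect (exists t, Theta° t /\ derive1 kappa t = mu) with
  | left e => projT1 (cid e)
  | right _ => 0
  end.

Definition EDF_l kappa Theta (delta y v phi : R) : \bar R :=
  ereal_inf [set mu%:E | mu in [set mu | mean_space kappa Theta mu /\
     (EDF_Fs kappa Theta (EDF_h kappa Theta mu) v phi y <= (1 - delta)%:E)%E]].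
Definition EDF_u kappa Theta (delta y v phi : R) : \bar R :=
  ereal_sup [set mu%:E | mu in [set mu | mean_space kappa Theta mu /\
     (delta%:E <= EDF_F kappa Theta (EDF_h kappa Theta mu) v phi y)%E]].

End EDF.

Definition vsum (R : realType) (n : nat) (v : 'I_n -> R) (j k : 'I_n) : R :=
  \sum_(i < n | (j <= i <= k)%N) v i.
Definition Zjk (R : realType) (T : Type) (n : nat) (v : 'I_n -> R)
    (Y : 'I_n -> T -> R) (j k : 'I_n) (x : T) : R :=
  (vsum v j k)^-1 * \sum_(i < n | (j <= i <= k)%N) v i * Y i x.

Definition mutually_independent d (T : measurableType d) (R : realType)
    (P : probability T R) (n : nat) (Y : 'I_n -> T -> R) : Prop :=
  forall B : 'I_n -> set R, (forall i, measurable (B i)) ->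
    P (\bigcap_(i in [set: 'I_n]) (Y i @^-1` B i)) =
    (\prod_(i < n) P (Y i @^-1` B i))%E.

Definition Lbound (R : realType) (kappa : R -> R) (Theta : set R) (phi : R)
    (T : Type) (n : nat) (theta v : 'I_n -> R) (Y : 'I_n -> T -> R)
    (J : {set 'I_n * 'I_n}) (delta : R) (i : 'I_n) (x : T) : \bar R :=
  if [exists p in J, theta p.2 <= theta i] then
    ereal_sup [set EDF_l kappa Theta delta (Zjk v Y p.1 p.2 x) (vsum v p.1 p.2) phi
              | p in [set p | p \in J /\ theta p.2 <= theta i]]
  else ereal_inf [set (derive1 kappa t)%:E | t in Theta°].
Definition Ubound (R : realType) (kappa : R -> R) (Theta : set R) (phi : R)
    (T : Type) (n : nat) (theta v : 'I_n -> R) (Y : 'I_n -> T -> R)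
    (J : {set 'I_n * 'I_n}) (delta : R) (i : 'I_n) (x : T) : \bar R :=
  if [exists p in J, theta i <= theta p.1] then
    ereal_inf [set EDF_u kappa Theta delta (Zjk v Y p.1 p.2 x) (vsum v p.1 p.2) phi
              | p in [set p | p \in J /\ theta i <= theta p.1]]
  else ereal_sup [set (derive1 kappa t)%:E | t in Theta°].

(* Main.v *)
Require Import Defs.
From HB Require Import structures.
From mathcomp Require Import all_boot all_order all_algebra.
From mathcomp Require Import all_classical all_reals all_analysis.
From mathcomp Require Import measurable_realfun ring lra.
Import Order.TTheory GRing.Theory Num.Theory.
Import numFieldNormedType.Exports.
Local Open Scope classical_set_scope.
Local Open Scope ring_scope.

(** Write w = v / phi. If Y follows EDF(theta, v, phi, kappa), the moment
    generating function of X = w Y is s |-> exp (w (kappa (theta + s) - kappa theta)),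
    so the laws of the X_i with a common theta are closed under convolution, and
    moving theta is an exponential tilt, which is stochastically monotone in
    theta.  Hence v_{j:k} / phi * Z_{j:k}, a sum of independent X_i with
    theta_j <= theta_i <= theta_k, lies stochastically between the laws with all
    parameters equal to theta_j and to theta_k.  Therefore
    F(Z_{j:k}; theta_j) < delta and F^*(Z_{j:k}; theta_k) > 1 - delta each have
    probability at most delta, and outside these 2 |J| events the band covers
    every mean, because kappa' is increasing on the interior of Theta.

    The distribution function F is only known through its moment generating
    function near 0, so the argument needs that this determines a probability
    measure.  Equality of the generating functions gives equality of all moments;
    expanding the sine, which is legitimate thanks to the exponential moments,
    the integrals of all polynomials in sin (eta x) agree for small eta, and such
    polynomials converge boundedly to the indicator of sin (eta x) > 0, which
    tends to the indicator of x > 0 as eta tends to 0. *)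

Set Implicit Arguments.
Unset Strict Implicit.
Unset Printing Implicit Defensive.

(** * Measures with a density *)

Section density.
Context d (T : measurableType d) (R : realType).
Variables (mu : {measure set T -> \bar R}) (g : T -> R).
Hypotheses (mg : measurable_fun setT g) (g0 : forall x, 0 <= g x).

(* The proofs are arguments only so that the measure structure attaches canonically. *)
Definition density (_ : measurable_fun setT g) (_ : forall x, 0 <= g x)
  (A : set T) : \bar R := (\int[mu]_(x in A) (g x)%:E)%E.

Local Notation nu := (density mg g0).

Let nu0 : nu set0 = 0%E.
Proof. by rewrite /density integral_set0. Qed.

Let nu_ge0 A : (0 <= nu A)%E.
Proof. by apply: integral_ge0 => x _; rewrite lee_fin. Qed.

Let nu_sigma_additive : semi_sigma_additive nu.
Proof.
move=> /= F mF tF mUF; rewrite /density; apply: cvg_toP.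
  apply: ereal_nondecreasing_is_cvgn => m n mn.
  by apply: lee_sum_nneg_natr => // k _ _; apply: integral_ge0 => /= x _;
     rewrite lee_fin.
rewrite ge0_integral_bigcup//=.
- by apply: measurable_funTS; exact/measurable_EFinP.
- by move=> x _; rewrite lee_fin.
Qed.

HB.instance Definition _ := isMeasure.Build _ _ _ nu nu0 nu_ge0 nu_sigma_additive.

Import HBNNSimple.

Let ge0_integral_density_nnsfun (h : {nnsfun T >-> R}) :
  (\int[nu]_x (h x)%:E = \int[mu]_x ((h x)%:E * (g x)%:E))%E.
Proof.
have mh r : measurable (h @^-1` [set r]) by [].
rewrite integral_nnsfun// patch_setT sintegralE.
under [RHS]eq_integral => x _.
  rewrite fimfunE -fsumEFin// ge0_mule_fsuml; last first.
    by move=> r; exact: nnfun_muleindic_ge0.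
  over.
rewrite ge0_integral_fsum//; last 2 first.
- move=> r; apply: emeasurable_funM; last exact: measurableT_comp.
  by apply/measurable_EFinP; exact: measurable_funM.
- move=> r x _; apply: mule_ge0; last by rewrite lee_fin.
  exact: nnfun_muleindic_ge0.
apply: eq_fsbigr => r; rewrite inE => -[x _ <-].
rewrite /= /density integral_mkcond.
transitivity (\int[mu]_y ((h x)%:E * ((fun y => (g y)%:E) \_ (h @^-1` [set h x])) y))%E.
  rewrite ge0_integralZl//.
  - apply/(measurable_restrictT _ _).1 => //.
    by apply: measurable_funTS; exact/measurable_EFinP.
  - by move=> y _; apply: erestrict_ge0 => z _; rewrite lee_fin.
  - by rewrite lee_fin.
apply: eq_integral => y _.
rewrite patchE EFinM -muleA indicE; case: ifPn => _; first by rewrite mul1e.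
by rewrite mul0e.
Qed.

Lemma ge0_integral_density (f : T -> \bar R) :
  measurable_fun setT f -> (forall x, 0 <= f x)%E ->
  (\int[nu]_x f x = \int[mu]_x (f x * (g x)%:E))%E.
Proof.
move=> mf f0; pose f_ := nnsfun_approx measurableT mf.
have fcvg x : EFin \o f_ ^~ x @ \oo --> f x by exact: cvg_nnsfun_approx.
transitivity (limn (fun n => \int[nu]_x (f_ n x)%:E))%E.
  rewrite -monotone_convergence//.
  - by apply: eq_integral => y _; apply/esym/cvg_lim => //; exact: fcvg.
  - by move=> n; exact/measurable_EFinP.
  - by move=> n y _; rewrite lee_fin.
  - by move=> y _ m n mn; rewrite lee_fin; exact/lefP/nd_nnsfun_approx.
under eq_fun do rewrite ge0_integral_density_nnsfun.
rewrite -monotone_convergence//.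
- apply: eq_integral => y _; apply/cvg_lim => //.
  by apply: cvgeMr => //; exact: fcvg.
- by move=> n; apply: emeasurable_funM; apply/measurable_EFinP.
- by move=> n y _; rewrite mule_ge0// lee_fin.
- move=> y _ m n mn; apply: lee_wpmul2r; first by rewrite lee_fin.
  by rewrite lee_fin; exact/lefP/nd_nnsfun_approx.
Qed.

End density.

(** * Moment generating functions *)

Section mgf.
Context (R : realType).
Implicit Types (Q : {measure set R -> \bar R}) (s e x : R).

Definition mgf Q s : \bar R := (\int[Q]_x (expR (s * x))%:E)%E.

Lemma measurable_expRM s : measurable_fun setT (fun x : R => expR (s * x)).
Proof. by apply: measurableT_comp => //; exact: measurable_funM. Qed.

Lemma mgf_ge0 Q s : (0 <= mgf Q s)%E.
Proof. by apply: integral_ge0 => x _; rewrite lee_fin expR_ge0. Qed.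

Lemma integrable_mgf Q s : (mgf Q s < +oo)%E ->
  Q.-integrable setT (fun x => (expR (s * x))%:E).
Proof.
move=> Qs; apply/integrableP; split.
  by apply/measurable_EFinP; exact: measurable_expRM.
under eq_integral do rewrite gee0_abs ?lee_fin ?expR_ge0//.
exact: Qs.
Qed.

Lemma measurable_expRnorm s : measurable_fun setT (fun x : R => expR (s * `|x|)).
Proof.
apply: measurableT_comp => //; apply: measurable_funM => //.
Qed.

Lemma integrable_expR_norm Q s : (mgf Q s < +oo)%E -> (mgf Q (- s) < +oo)%E ->
  Q.-integrable setT (fun x => (expR (s * `|x|))%:E).
Proof.
move=> Qs QNs.
apply: (@le_integrable _ _ _ _ _ measurableT _
    (fun x => (expR (s * x))%:E + (expR (- s * x))%:E)%E); last first.
- by apply: integrableD => //; exact: integrable_mgf.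
- move=> x _; rewrite -EFinD /= lee_fin (ger0_norm (expR_ge0 _)) (ger0_norm (addr_ge0 (expR_ge0 _) (expR_ge0 _))).
  have [x0|x0] := leP 0 x.
    by rewrite ger0_norm// lerDl expR_ge0.
  by rewrite ltr0_norm// mulrN mulNr lerDr expR_ge0.
- by apply/measurable_EFinP; exact: measurable_expRnorm.
Qed.

Lemma normX_le_expR (r x : R) k : 0 < r ->
  `|x| ^+ k <= k`!%:R / r ^+ k * expR (r * `|x|).
Proof.
move=> r0; have rx0 : 0 <= r * `|x| by rewrite mulr_ge0// ltW.
have : (r * `|x|) ^+ k / k`!%:R <= expR (r * `|x|).
  case: k => [|k].
    by rewrite expr0 fact0 divr1 (le_trans _ (expR_ge1Dx _))// lerDl.
  by rewrite (le_trans _ (expR_ge1Dxn k rx0))// lerDr.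
rewrite ler_pdivrMr ?ltr0n ?fact_gt0// exprMn mulrAC => h.
by rewrite ler_pdivlMr ?exprn_gt0// [_ * r ^+ _]mulrC [_%:R * _]mulrC.
Qed.

Definition mgf_near Q e := 0 < e /\ forall s, `|s| < e -> (mgf Q s < +oo)%E.

Lemma integrable_powexp Q e k s : mgf_near Q e -> s < e ->
  Q.-integrable setT (fun x => (`|x| ^+ k * expR (s * `|x|))%:E).
Proof.
move=> [e0 Qe] se; pose t := Num.max s 0.
have t0 : 0 <= t by rewrite le_max lexx orbT.
have st : s <= t by rewrite le_max lexx.
have te : t < e by rewrite gt_max se.
pose r := (e - t) / 2.
have r0 : 0 < r by rewrite /r; lra.
have rt0 : 0 <= r + t by rewrite /r; lra.
have rte : `|r + t| < e by rewrite ger0_norm// /r; lra.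
set C : R := k`!%:R / r ^+ k.
have C0 : 0 <= C by rewrite /C divr_ge0// exprn_ge0// ltW.
apply: (@le_integrable _ _ _ _ _ measurableT _
    (fun x => C%:E * (expR ((r + t) * `|x|))%:E)%E); last first.
- apply: integrableZl => //; apply: integrable_expR_norm; apply: Qe => //.
  by rewrite normrN.
- move=> x _; rewrite -EFinM /= lee_fin (ger0_norm (mulr_ge0 (exprn_ge0 _ (normr_ge0 _)) (expR_ge0 _))).
  apply: le_trans (ler_norm _).
  rewrite mulrDl expRD mulrA.
  rewrite ler_pM ?expR_ge0 ?exprn_ge0//.
    exact: normX_le_expR.
  by rewrite ler_expR ler_wpM2r.
- apply/measurable_EFinP/measurable_funM; last exact: measurable_expRnorm.
  by apply: measurable_funX; apply: normr_measurable.
Qed.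

Lemma integrable_le_powexp Q e (f : R -> R) (C : R) k s :
  mgf_near Q e -> s < e -> measurable_fun setT f ->
  (forall x, `|f x| <= C * (`|x| ^+ k * expR (s * `|x|))) ->
  Q.-integrable setT (EFin \o f).
Proof.
move=> Qe se mf fC.
apply: (@le_integrable _ _ _ _ _ measurableT _
    (fun x => C%:E * (`|x| ^+ k * expR (s * `|x|))%:E)%E); last first.
- by apply: integrableZl => //; exact: integrable_powexp Qe se.
- by move=> x _; rewrite -EFinM /= lee_fin (le_trans (fC x))// ler_norm.
- exact/measurable_EFinP.
Qed.

Lemma integrable_monexp Q e k s : mgf_near Q e -> `|s| < e ->
  Q.-integrable setT (EFin \o (fun x => x ^+ k * expR (s * x))).
Proof.
move=> Qe se; apply: (@integrable_le_powexp _ _ _ 1 k `|s| Qe se).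
  by apply: measurable_funM; [exact: measurable_funX|exact: measurable_expRM].
move=> x; rewrite mul1r normrM normrX (ger0_norm (expR_ge0 _)).
by rewrite ler_wpM2l ?exprn_ge0// ler_expR -normrM ler_norm.
Qed.

Lemma is_derive_mgf Q e k s : mgf_near Q e -> `|s| < e ->
  is_derive s 1 (fun t => \int[Q]_x (x ^+ k * expR (t * x)))
    (\int[Q]_x (x ^+ k.+1 * expR (s * x))).
Proof.
move=> Qe se; pose t : R := (`|s| + e) / 2.
have te : t < e by rewrite /t; lra.
have st : `|s| < t by rewrite /t; lra.
have Is : `]- t, t[%classic s.
  by rewrite /= in_itv/=; move: st; rewrite ltr_norml.
have It (u : R) : `]- t, t[%classic u -> `|u| < t by rewrite /= in_itv/= ltr_norml.
pose f (u x : R) := x ^+ k * expR (u * x) : R.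
have df (u x : R) : is_derive u 1 (f ^~ x) (x ^+ k.+1 * expR (u * x)).
  rewrite /f; apply: is_derive_eq.
  by rewrite /GRing.scale/= mulr0 add0r mulr1 exprSr [expR _ * x]mulrC mulrA.
have d1f (u x : R) : partial1of2 f u x = x ^+ k.+1 * expR (u * x).
  by rewrite partial1of2E; exact: derive_val.
have G0 (x : R) : 0 <= `|x| ^+ k.+1 * expR (t * `|x|) by rewrite mulr_ge0 ?expR_ge0// exprn_ge0.
have intf (u : R) : `]- t, t[%classic u -> Q.-integrable setT (EFin \o f u).
  by move=> /It ut; apply: integrable_monexp Qe _; exact: lt_trans te.
have derf (u x : R) : `]- t, t[%classic u -> setT x -> derivable (f ^~ x) u 1.
  by move=> _ _; exact: ex_derive.
have G_ub (u x : R) : `]- t, t[%classic u -> setT x ->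
    `|partial1of2 f u x| <= `|x| ^+ k.+1 * expR (t * `|x|).
  move=> /It ut _; rewrite d1f normrM normrX (ger0_norm (expR_ge0 _)).
  rewrite ler_wpM2l ?exprn_ge0// ler_expR (le_trans (ler_norm _))// normrM.
  by rewrite ler_wpM2r// ltW.
have intG := integrable_powexp k.+1 Qe te.
apply: DeriveDef.
  exact: (derivable_under_integral measurableT Is intf derf G0 intG G_ub).
rewrite -derive1E.
rewrite (differentiation_under_integral measurableT Is intf derf G0 intG G_ub).
by apply: eq_Rintegral => x _; rewrite d1f.
Qed.

Lemma mgf_moments_eq Q1 Q2 e k s : mgf_near Q1 e -> mgf_near Q2 e ->
  (forall s, `|s| < e -> mgf Q1 s = mgf Q2 s) -> `|s| < e ->
  \int[Q1]_x (x ^+ k * expR (s * x)) = \int[Q2]_x (x ^+ k * expR (s * x)).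
Proof.
move=> Q1e Q2e Q12; elim: k s => [|k IH] s se.
  rewrite /Rintegral; congr fine.
  under eq_integral do rewrite expr0 mul1r.
  under [RHS]eq_integral do rewrite expr0 mul1r.
  exact: Q12.
have d1 := is_derive_mgf k Q1e se; have d2 := is_derive_mgf k Q2e se.
rewrite -(derive_val (is_derive := d1)) -(derive_val (is_derive := d2)).
apply: near_eq_derive; near=> t; apply: IH.
by near: t; apply: (@cvgr_lt _ _ _ _ _ _ (@norm_continuous _ R^o s)).
Unshelve. all: by end_near. Qed.

End mgf.

Lemma Rintegral_dominated_cvg d (T : measurableType d) (R : realType)
    (mu : {measure set T -> \bar R}) (h_ : nat -> T -> R) (h g : T -> R) :
  (forall n, measurable_fun setT (h_ n)) ->
  (forall x, h_ ^~ x @ \oo --> h x) ->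
  mu.-integrable setT (EFin \o g) -> (forall n x, `|h_ n x| <= g x) ->
  mu.-integrable setT (EFin \o h) /\
  \int[mu]_x h_ n x @[n --> \oo] --> \int[mu]_x h x.
Proof.
move=> mh hcvg ig hg.
have hE x : (EFin \o h_ ^~ x) @ \oo --> (h x)%:E.
  by apply: cvg_EFin; [exact: nearW|exact: hcvg].
have mhE n : measurable_fun setT (EFin \o h_ n) by exact/measurable_EFinP.
have mh0 : measurable_fun setT (EFin \o h).
  by apply: (emeasurable_fun_cvg (fun n => EFin \o h_ n)) => // x _; exact: hE.
have ih : mu.-integrable setT (EFin \o h).
  apply: (@le_integrable _ _ _ _ _ measurableT _ (EFin \o g)) => // x _.
  rewrite /= lee_fin (le_trans _ (ler_norm _))//.
  apply: (cvgr_to_le (cvg_norm (hcvg x))).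
  by apply: nearW => n; exact: hg.
split => //; apply: fine_cvg; rewrite fineK; last exact: integrable_fin_num.
have gE n x : setT x -> (`|(EFin \o h_ n) x| <= (EFin \o g) x)%E.
  by move=> _; rewrite /= lee_fin.
exact: (@dominated_cvg _ _ _ mu _ measurableT (fun n => EFin \o h_ n)
  (EFin \o h) (EFin \o g) mhE (fun x _ => hE x) (fun x _ => erefl) ig gE).
Qed.

Section sin_series.
Context (R : realType).
Implicit Types x : R.

Lemma cvg_series_sin x : series (sin_coeff x) @ \oo --> sin x.
Proof. by rewrite unlock; exact: is_cvg_series_sin_coeff. Qed.

Lemma series_sin_coeff_le x n : `|series (sin_coeff x) n| <= expR `|x|.
Proof.
apply: (@le_trans _ _ (series (exp_coeff `|x|) n)).
  rewrite /series/= (le_trans (ler_norm_sum _ _ _))// ler_sum// => i _.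
  rewrite /exp_coeff /sin_coeff/=.
  rewrite !normrM normfV !normr_nat !normrX normrN normr1 expr1n mulr1.
  by case: odd; [rewrite mul1r|rewrite !mul0r divr_ge0].
rewrite /expR; apply: nondecreasing_cvgn_le; last exact: is_cvg_series_exp_coeff.
by apply: nondecreasing_series => i _ _; exact: exp_coeff_ge0.
Qed.

End sin_series.

Section sign_iteration.
Context (R : realType).
Implicit Types u : R.

(* Iterating u |-> (3u - u^3)/2 pushes [-1, 1] towards the sign of u. *)
Fixpoint sgn_iter n u : R :=
  if n is k.+1 then 3 / 2 * sgn_iter k u - 1 / 2 * sgn_iter k u ^+ 3 else u.

Lemma sgn_iterN n u : sgn_iter n (- u) = - sgn_iter n u.
Proof. by elim: n => //= n ->; rewrite -!mulrN; ring. Qed.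

Lemma sgn_iter_ge n u : 0 <= u <= 1 -> u <= sgn_iter n u <= 1.
Proof.
move=> /andP[u0 u1]; elim: n => [|n /=]; first by rewrite lexx.
set w := sgn_iter n u => /andP[uw w1]; have w0 : 0 <= w by exact: le_trans uw.
have h1 : 0 <= w * (1 - w) * (1 + w) by rewrite !mulr_ge0 ?subr_ge0 ?addr_ge0.
have h2 : 0 <= (1 - w) ^+ 2 * (2 + w) by rewrite mulr_ge0 ?sqr_ge0 ?addr_ge0.
apply/andP; split; lra.
Qed.

Lemma sgn_iter_pos_bound n u : 0 <= u <= 1 -> 1 - sgn_iter n u <= (1 - u / 2) ^+ n.
Proof.
move=> u01; elim: n => [|n IH /=]; first by rewrite expr0 /= lerBlDr lerDl; lra.
have := sgn_iter_ge n u01; move: IH; set w := sgn_iter n u => IH /andP[uw w1].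
move/andP: u01 => [u0 u1].
rewrite [leRHS]exprS [leLHS](_ : _ = (1 - w / 2 - w ^+ 2 / 2) * (1 - w)); last by field.
by apply: ler_pM => //; nra.
Qed.

Lemma sgn_iter_norm n u : `|u| <= 1 -> `|sgn_iter n u| <= 1.
Proof.
wlog u0 : u / 0 <= u => [h|].
  have [/h//|u0] := leP 0 u.
  by rewrite -normrN -(normrN (sgn_iter _ _)) -sgn_iterN; apply: h; rewrite oppr_ge0 ltW.
rewrite ger0_norm// => u1; have /andP[h1 h2] := @sgn_iter_ge n u (introT andP (conj u0 u1)).
by rewrite ger0_norm// (le_trans u0).
Qed.

Lemma cvg_sgn_iter_pos u : 0 < u <= 1 -> sgn_iter n u @[n --> \oo] --> (1 : R).
Proof.
move=> /andP[u0 u1]; have u01 : 0 <= u <= 1 by rewrite ltW.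
apply/subr_cvg0.
have : - (1 - u / 2) ^+ n @[n --> \oo] --> - (0 : R).
  apply: cvgN; apply: cvg_expr; rewrite ger0_norm; lra.
rewrite oppr0 => h; apply: (squeeze_cvgr _ h (cvg_cst 0)).
apply: nearW => n; have := sgn_iter_pos_bound n u01.
have /andP[_] := sgn_iter_ge n u01; lra.
Qed.

Lemma sgn_iter0 n : sgn_iter n 0 = 0.
Proof. by elim: n => //= n ->; rewrite expr0n/= !mulr0 subr0. Qed.

Definition pos_poly n u := (1 + sgn_iter n u) / 2 - (1 - u ^+ 2) ^+ n / 2.

Lemma pos_poly_norm n u : `|u| <= 1 -> `|pos_poly n u| <= 1.
Proof.
move=> u1; have := sgn_iter_norm n u1; rewrite /pos_poly !ler_norml.
move: u1; rewrite ler_norml => u1.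
have u20 : 0 <= 1 - u ^+ 2 by nra.
have u21 : 1 - u ^+ 2 <= 1 by nra.
have := exprn_ge0 n u20; have := exprn_ile1 n u20 u21.
move: (_ ^+ n) (sgn_iter n u) => a b; lra.
Qed.

Lemma cvg_pos_poly u : `|u| <= 1 -> pos_poly n u @[n --> \oo] --> ((0 < u)%R%:R : R).
Proof.
move=> u1; have [u0|u0|->] := ltrgt0P u.
- have -> : (1 : R) = (1 + 1) / 2 - 0 / 2 by field.
  apply: cvgB; apply: cvgMl.
    by apply: cvgD; [exact: cvg_cst|apply: cvg_sgn_iter_pos; rewrite u0 (le_trans (ler_norm _))].
  by apply: cvg_expr; move: u1; rewrite ler_norml ltr_norml => u1; apply/andP; split; nra.
- rewrite mulr0n; have -> : (0 : R) = (1 + - 1) / 2 - 0 / 2 by field.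
  apply: cvgB; apply: cvgMl.
    apply: cvgD; first exact: cvg_cst.
    rewrite -(opprK u); under eq_fun do rewrite sgn_iterN.
    apply: cvgN; apply: cvg_sgn_iter_pos; rewrite oppr_gt0 u0.
    by rewrite (le_trans (ler_norm _))// normrN.
  by apply: cvg_expr; move: u1; rewrite ler_norml ltr_norml => u1; apply/andP; split; nra.
- rewrite /pos_poly; under eq_fun do rewrite sgn_iter0 expr0n/= subr0 expr1n addr0 subrr.
  exact: cvg_cst.
Qed.

End sign_iteration.

(** * Uniqueness *)

Section mgf_unique.
Context (R : realType).
Variables (Q1 Q2 : probability R R) (e : R).
Hypotheses (Q1e : mgf_near Q1 e) (Q2e : mgf_near Q2 e).
Hypothesis Q12 : forall s, `|s| < e -> mgf Q1 s = mgf Q2 s.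

Let inteq (h : R -> R) :=
  [/\ Q1.-integrable setT (EFin \o h), Q2.-integrable setT (EFin \o h)
    & \int[Q1]_x h x = \int[Q2]_x h x].

Let inteqD h1 h2 : inteq h1 -> inteq h2 -> inteq (fun x => h1 x + h2 x).
Proof.
move=> [i11 i12 e1] [i21 i22 e2]; split.
- exact: (integrableD measurableT i11 i21).
- exact: (integrableD measurableT i12 i22).
- by rewrite !RintegralD// e1 e2.
Qed.

Let inteqZ c h : inteq h -> inteq (fun x => c * h x).
Proof.
move=> [i1 i2 e1]; split.
- exact: (integrableZl measurableT c i1).
- exact: (integrableZl measurableT c i2).
- by rewrite !RintegralZl// e1.
Qed.

Let inteq0 : inteq (fun=> 0).
Proof.
split; [exact: integrable0|exact: integrable0|].
by rewrite !Rintegral_cst// !mul0r.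
Qed.

Let inteq_lim (h_ : nat -> R -> R) (h g : R -> R) :
  (forall n, measurable_fun setT (h_ n)) -> (forall n, inteq (h_ n)) ->
  (forall x, h_ ^~ x @ \oo --> h x) ->
  Q1.-integrable setT (EFin \o g) -> Q2.-integrable setT (EFin \o g) ->
  (forall n x, `|h_ n x| <= g x) -> inteq h.
Proof.
move=> mh hh hcvg ig1 ig2 hg.
have [i1 c1] := Rintegral_dominated_cvg mh hcvg ig1 hg.
have [i2 c2] := Rintegral_dominated_cvg mh hcvg ig2 hg.
have c12 : \int[Q1]_x h_ n x @[n --> \oo] --> \int[Q2]_x h x.
  by under eq_fun => n do (have [_ _ ->] := hh n).
by split => //; exact: (cvg_unique (@Rhausdorff R) c1 c12).
Qed.

Let momeq (f : R -> R) := [/\ measurable_fun setT f,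
  exists M : R, forall x, `|f x| <= M & forall k, inteq (fun x => x ^+ k * f x)].

(* The multipliers form an algebra; a sequence of polynomials in
   [sin (eta * x)] then isolates the half-line of positive numbers. *)
Let multiplier (m : R -> R) := forall f, momeq f -> momeq (fun x => m x * f x).

Let momeq1 : momeq (fun=> 1).
Proof.
split; first exact: measurable_cst.
  by exists 1 => x; rewrite normr1.
have e0 : `|0 : R| < e by rewrite normr0; case: Q1e.
move=> k; have E : (fun x : R => x ^+ k * 1) = (fun x => x ^+ k * expR (0 * x)).
  by apply/funext => x; rewrite mul0r expR0.
by rewrite E; split; [exact: integrable_monexp Q1e _|exact: integrable_monexp Q2e _
  |exact: mgf_moments_eq Q1e Q2e Q12 e0].
Qed.

Let multD m1 m2 : multiplier m1 -> multiplier m2 -> multiplier (fun x => m1 x + m2 x).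
Proof.
move=> h1 h2 f ff; have [m1f [M1 b1] e1] := h1 _ ff; have [m2f [M2 b2] e2] := h2 _ ff.
have E : (fun x => (m1 x + m2 x) * f x) = (fun x => m1 x * f x + m2 x * f x).
  by apply/funext => x; rewrite mulrDl.
rewrite E; split; first exact: measurable_funD.
  by exists (M1 + M2) => x; rewrite (le_trans (ler_normD _ _))// lerD.
move=> k; have -> : (fun x => x ^+ k * (m1 x * f x + m2 x * f x)) =
    (fun x => x ^+ k * (m1 x * f x) + x ^+ k * (m2 x * f x)).
  by apply/funext => x; rewrite mulrDr.
exact: inteqD.
Qed.

Let mult_cst c : multiplier (fun=> c).
Proof.
move=> f [mf [M b] ef]; split; first exact: measurable_funM.
  by exists (`|c| * M) => x; rewrite normrM ler_wpM2l.
move=> k; have -> : (fun x => x ^+ k * (c * f x)) = (fun x => c * (x ^+ k * f x)).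
  by apply/funext => x; rewrite mulrCA.
exact: inteqZ.
Qed.

Let multM m1 m2 : multiplier m1 -> multiplier m2 -> multiplier (fun x => m1 x * m2 x).
Proof.
move=> h1 h2 f ff; have -> : (fun x => m1 x * m2 x * f x) = (fun x => m1 x * (m2 x * f x)).
  by apply/funext => x; rewrite mulrA.
exact/h1/h2.
Qed.

Let multX m n : multiplier m -> multiplier (fun x => m x ^+ n).
Proof.
move=> hm; elim: n => [|n IH]; first exact: mult_cst.
have -> : (fun x => m x ^+ n.+1) = (fun x => m x * m x ^+ n).
  by apply/funext => x; rewrite exprS.
exact: multM.
Qed.

Let mult_sin (eta : R) : 0 < eta < e -> multiplier (fun x => sin (eta * x)).
Proof.
move=> /andP[eta0 etae] f [mf [M fM] ef].
have ms : measurable_fun setT (fun x : R => sin (eta * x)).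
  apply: measurableT_comp; last exact: measurable_funM.
  by apply: continuous_measurable_fun; exact: continuous_sin.
have M0 : 0 <= M by exact: le_trans (fM 0).
split; first exact: measurable_funM.
  exists M => x; rewrite normrM -[leRHS]mul1r; apply: ler_pM => //.
  exact: sin_max.
move=> k.
pose c j : R := (odd j)%:R * (-1) ^+ j.-1./2 * (j`!%:R)^-1 * eta ^+ j.
pose S n x := \sum_(0 <= j < n) c j * (x ^+ (k + j) * f x).
have SE n x : S n x = x ^+ k * (series (sin_coeff (eta * x)) n * f x).
  rewrite /S sin_coeffE /series/= big_distrl/= big_distrr/=; apply: eq_bigr => j _.
  by rewrite /c exprMn exprD; ring.
have mk j : measurable_fun setT (fun x : R => c j * (x ^+ (k + j) * f x)).
  by apply: measurable_funM => //; apply: measurable_funM => //; exact: measurable_funX.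
pose g (x : R) := M * (`|x| ^+ k * expR (eta * `|x|)).
have ig (Q : probability R R) : mgf_near Q e -> Q.-integrable setT (EFin \o g).
  by move=> Qe; exact: (integrableZl measurableT M (integrable_powexp k Qe etae)).
apply: (@inteq_lim S _ g) => //.
- by move=> n; exact: measurable_sum.
- elim=> [|n IH].
    rewrite (_ : S 0%N = fun=> 0); first exact: inteq0.
    by apply/funext => x; rewrite /S big_geq.
  rewrite (_ : S n.+1 = fun x => S n x + c n * (x ^+ (k + n) * f x)).
    by apply: inteqD => //; apply: inteqZ; exact: ef.
  by apply/funext => x; rewrite /S big_nat_recr.
- move=> x; under eq_fun do rewrite SE.
  apply: cvgMr; apply: cvgMl; exact: cvg_series_sin.
- exact: ig.
- exact: ig.
- move=> n x; rewrite SE /g [leRHS]mulrCA !normrM normrX ler_wpM2l ?exprn_ge0//.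
  rewrite [leRHS]mulrC; apply: ler_pM => //.
  by rewrite (le_trans (series_sin_coeff_le _ _))// normrM gtr0_norm.
Qed.

Let mult_pos_poly (eta : R) n : 0 < eta < e ->
  multiplier (fun x => pos_poly n (sin (eta * x))).
Proof.
move=> he; have ms := mult_sin he.
have mi : multiplier (fun x => sgn_iter n (sin (eta * x))).
  elim: n => [|n IH] //=; apply: multD; first by apply: multM => //; exact: mult_cst.
  have -> : (fun x => - (1 / 2 * sgn_iter n (sin (eta * x)) ^+ 3)) =
    (fun x => - (1 / 2) * sgn_iter n (sin (eta * x)) ^+ 3).
    by apply/funext => x; rewrite mulNr.
  by apply: multM; [exact: mult_cst|exact: multX].
have -> : (fun x => pos_poly n (sin (eta * x))) =
    (fun x => (1 + sgn_iter n (sin (eta * x))) * 2^-1 +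
      (- 2^-1) * (1 + (-1) * sin (eta * x) ^+ 2) ^+ n).
  by apply/funext => x; rewrite /pos_poly mulN1r mulNr [2^-1 * _]mulrC.
apply: multD.
  by apply: multM; [apply: multD => //; exact: mult_cst|exact: mult_cst].
apply: multM; first exact: mult_cst.
apply/multX/multD; first exact: mult_cst.
by apply: multM; [exact: mult_cst|exact: multX].
Qed.

Let int1 (Q : probability R R) : Q.-integrable setT (EFin \o (fun=> 1 : R)).
Proof. exact: (finite_measure_integrable_cst Q 1). Qed.

Let inteq_pos_sin (eta : R) : 0 < eta < e -> measurable_fun setT (fun x : R => (0 < sin (eta * x))%R%:R : R)
  /\ inteq (fun x => (0 < sin (eta * x))%R%:R).
Proof.
move=> he.
have h n : momeq (fun x => pos_poly n (sin (eta * x)) * 1) := mult_pos_poly n he momeq1.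
have mn n : measurable_fun setT (fun x : R => pos_poly n (sin (eta * x))).
  by have [mh _ _] := h n; under eq_fun do rewrite -(mulr1 (pos_poly _ _)).
have hc x : pos_poly n (sin (eta * x)) @[n --> \oo] --> ((0 < sin (eta * x))%R%:R : R).
  by apply: cvg_pos_poly; exact: sin_max.
split; first by apply: (measurable_fun_cvg mn) => x _; exact: hc.
apply: (inteq_lim mn _ hc (int1 Q1) (int1 Q2)).
- move=> n; have [_ _ /(_ 0%N)] := h n.
  by under eq_fun do rewrite expr0 mul1r mulr1.
- by move=> n x; apply: pos_poly_norm; exact: sin_max.
Qed.

Lemma mgf_unique_pos : Q1 `]0, +oo[%classic = Q2 `]0, +oo[%classic.
Proof.
have [e0 _] := Q1e; pose eta n := e / n.+2%:R.
have he n : 0 < eta n < e.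
  by rewrite divr_gt0//= ltr_pdivrMr// ltr_pMr// ltr1n.
have etac x : eta n * x @[n --> \oo] --> (0 : R).
  rewrite -[X in _ --> X](mul0r x); apply: cvgMl.
  rewrite -[X in _ --> X](mulr0 e); apply: cvgMr.
  have := @cvg_harmonic R; rewrite -cvg_shiftS; exact.
have pos_sin (y : R) : `|y| < 2 -> (0 < sin y) = (0 < y).
  move=> y2; have [y0|y0|->] := ltrgt0P y; last by rewrite sin0 ltxx.
    by apply: sin2_gt0; rewrite y0 -(gtr0_norm y0).
  apply/negbTE; rewrite -leNgt -oppr_ge0 -sinN ltW// sin2_gt0//.
  by rewrite oppr_gt0 y0 -(ltr0_norm y0).
have : inteq (fun x : R => (0 < x)%R%:R).
  apply: (@inteq_lim (fun n x => (0 < sin (eta n * x))%R%:R) _ (fun=> 1)) => //.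
  - by move=> n; have [] := inteq_pos_sin (he n).
  - by move=> n; have [] := inteq_pos_sin (he n).
  - move=> x; apply: cvg_near_cst; near=> n.
    rewrite pos_sin; last first.
      near: n; apply: (@cvgr_lt _ _ _ _ _ _ (cvg_norm (etac x))).
      by rewrite normr0.
    by rewrite pmulr_rgt0//; case/andP: (he n).
  - by move=> n x; case: (_ < _); rewrite ?normr1 ?normr0.
case=> _ _; rewrite /Rintegral => E.
have I (Q : probability R R) : fine (\int[Q]_x ((0 < x)%R%:R)%:E) = fine (Q `]0, +oo[%classic).
  congr fine; rewrite -[in RHS](setIT `]0, +oo[%classic) -integral_indic//.
  by apply: eq_integral => x _; rewrite indicE mem_setE in_itv/= andbT.
rewrite -[LHS]fineK ?fin_num_measure// -[RHS]fineK ?fin_num_measure//.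
by rewrite -!I E.
Unshelve. all: by end_near. Qed.

End mgf_unique.

Lemma mgf_distribution d (T : measurableType d) (R : realType)
    (P : probability T R) (X : {mfun T >-> R}) (s : R) :
  mgf (distribution P X) s = (\int[P]_x (expR (s * X x))%:E)%E.
Proof.
rewrite /mgf ge0_integral_distribution//.
by apply/measurable_EFinP; exact: measurable_expRM.
Qed.

Theorem mgf_unique (R : realType) (Q1 Q2 : probability R R) (e : R) :
  0 < e -> (forall s, `|s| < e -> (mgf Q1 s < +oo)%E) ->
  (forall s, `|s| < e -> mgf Q1 s = mgf Q2 s) ->
  forall A, measurable A -> Q1 A = Q2 A.
Proof.
move=> e0 Q1e Q12.
have ray b : Q1 `]b, +oo[%classic = Q2 `]b, +oo[%classic.
  pose X := (fun x => x - b) : R -> R.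
  have mX : measurable_fun setT X by exact: measurable_funB.
  pose X' : {mfun R >-> R} := HB.pack X (isMeasurableFun.Build _ _ _ _ _ mX).
  have shift (Q : probability R R) s :
      (mgf (distribution Q X') s = (expR (- (s * b)))%:E * mgf Q s)%E.
    rewrite mgf_distribution /mgf -ge0_integralZl//; last first.
      by apply/measurable_EFinP; exact: measurable_expRM.
    apply: eq_integral => x _.
    by rewrite -EFinM -expRD /= /X mulrBr addrC.
  have pre : X @^-1` `]0, +oo[ = `]b, +oo[%classic.
    by apply/seteqP; split => x /=; rewrite !in_itv/= !andbT /X subr_gt0.
  have D (Q : probability R R) : distribution Q X' `]0, +oo[%classic = Q `]b, +oo[%classic.
    by rewrite -pre.
  rewrite -(D Q1) -(D Q2).
  apply: (@mgf_unique_pos R (distribution Q1 X') (distribution Q2 X') e).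
  - split=> // s se; rewrite shift lte_mul_pinfty// ?lee_fin ?expR_ge0//.
    exact: Q1e.
  - split=> // s se; rewrite shift lte_mul_pinfty// ?lee_fin ?expR_ge0//.
    by rewrite -Q12//; exact: Q1e.
  - by move=> s se; rewrite !shift Q12.
apply: (measure_unique (@RGenOInfty.G R) (fun n => `](- n%:R), +oo[%classic)).
- exact: RGenOInfty.measurableE.
- move=> _ _ [x ->] [y ->]; exists (Num.max x y).
  by apply/seteqP; split => z /=; rewrite !in_itv/= !andbT gt_max; [move=> [-> ->]|move=> /andP[]].
- by move=> n; exists (- n%:R).
- rewrite -subTset => x _; exists (Num.truncn (- x)).+1 => //=.
  by rewrite in_itv/= andbT ltrNl truncnS_gt.
- by move=> _ [x ->]; exact: ray.
- by move=> n; rewrite (le_lt_trans (probability_le1 _ _)) ?ltry.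
Qed.

(** * Convolution, stochastic order and tilting *)

Section probability_of_measure.
Context d (T : measurableType d) (R : realType).
Variables (mu : {measure set T -> \bar R}) (mu1 : mu setT = 1%E).

Let mup (_ : mu setT = 1%E) : set T -> \bar R := mu.

Let mup_sigma_additive : semi_sigma_additive (mup mu1).
Proof. exact: measure_semi_sigma_additive. Qed.

HB.instance Definition _ := isMeasure.Build _ _ _ (mup mu1)
  (measure0 mu) (measure_ge0 mu) mup_sigma_additive.

HB.instance Definition _ := Measure_isProbability.Build _ _ _ (mup mu1) mu1.

Lemma probability_of_measure : exists Q : probability T R, forall A, Q A = mu A.
Proof. by exists (mup mu1). Qed.

End probability_of_measure.

Section convolution.
Context (R : realType).
Implicit Types A B : probability R R.

Definition sum2 (z : R * R) : R := z.1 + z.2.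

Let measurable_sum2 : measurable_fun setT sum2.
Proof. by apply: measurable_funD; [exact: measurable_fst|exact: measurable_snd]. Qed.

HB.instance Definition _ := isMeasurableFun.Build _ _ _ _ sum2 measurable_sum2.

Definition conv A B : probability R R := distribution (A \x B)%E sum2.

Lemma mgf_conv A B s : (mgf (conv A B) s = mgf A s * mgf B s)%E.
Proof.
rewrite mgf_distribution fubini_tonelli1//; last first.
  apply/measurable_EFinP; apply: measurableT_comp => //.
  exact: measurable_funM.
rewrite /fubini_F /=.
under eq_integral => x _.
  under eq_integral => y _ do rewrite /sum2/= mulrDr expRD EFinM.
  rewrite ge0_integralZl//; last by apply/measurable_EFinP; exact: measurable_expRM.
  over.
rewrite /= ge0_integralZr//; last exact: mgf_ge0.
by apply/measurable_EFinP; exact: measurable_expRM.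
Qed.

Definition stle A B := forall y, (B `]-oo, y]%classic <= A `]-oo, y]%classic)%E.

Let D y := [set z : R * R | sum2 z <= y].

Let mD y : measurable (D y).
Proof.
have -> : D y = setT `&` sum2 @^-1` `]-oo, y]%classic.
  by apply/seteqP; split => z /=; rewrite in_itv/= => // -[].
exact: measurable_sum2.
Qed.

Let xD y x : xsection (D y) x = `]-oo, y - x]%classic.
Proof.
by apply/seteqP; split => z; rewrite /xsection/= mem_setE in_itv/= /sum2/= lerBrDl.
Qed.

Let yD y x : ysection (D y) x = `]-oo, y - x]%classic.
Proof.
by apply/seteqP; split => z; rewrite /ysection/= mem_setE in_itv/= /sum2/= lerBrDr.
Qed.

Let convx A B y : conv A B `]-oo, y]%classic = (\int[A]_x B (xsection (D y) x))%E.
Proof. by []. Qed.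

Let convy A B y : conv A B `]-oo, y]%classic = (\int[B]_x A (ysection (D y) x))%E.
Proof.
rewrite convx; have := indic_fubini_tonelli A B (mD y).
by rewrite indic_fubini_tonelli_FE// indic_fubini_tonelli_GE.
Qed.

Lemma stle_conv A A' B B' : stle A A' -> stle B B' -> stle (conv A B) (conv A' B').
Proof.
move=> AA' BB' y; apply: (@le_trans _ _ (conv A B' `]-oo, y]%classic)).
  rewrite !convy; apply: ge0_le_integral => //.
  - exact: measurable_fun_ysection.
  - exact: measurable_fun_ysection.
  - by move=> x _; rewrite yD; exact: AA'.
rewrite !convx; apply: ge0_le_integral => //.
- exact: measurable_fun_xsection.
- exact: measurable_fun_xsection.
- by move=> x _; rewrite xD; exact: BB'.
Qed.

End convolution.

Section tilt.
Context (R : realType).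

Lemma exponential_tilt (Q : probability R R) (a c : R) : mgf Q a = (expR c)%:E ->
  exists Q' : probability R R,
    [/\ forall s, mgf Q' s = (mgf Q (s + a) * (expR (- c))%:E)%E,
        0 <= a -> stle Q Q' & a <= 0 -> stle Q' Q].
Proof.
move=> Qa; pose g x := expR (a * x) * expR (- c) : R.
have mg : measurable_fun setT g by apply: measurable_funM => //; exact: measurable_expRM.
have g0 x : 0 <= g x by rewrite mulr_ge0 ?expR_ge0.
have Qg s : (\int[Q]_x ((expR (s * x))%:E * (g x)%:E) = mgf Q (s + a) * (expR (- c))%:E)%E.
  rewrite /mgf -ge0_integralZr ?lee_fin ?expR_ge0//; last first.
    by apply/measurable_EFinP; exact: measurable_expRM.
  by apply: eq_integral => x _; rewrite -!EFinM /g mulrA -expRD mulrDl.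
have /probability_of_measure[Q' Q'E] : density Q mg g0 setT = 1%E.
  rewrite /density; transitivity (\int[Q]_x ((expR (0 * x))%:E * (g x)%:E))%E.
    by apply: eq_integral => x _; rewrite mul0r expR0 mul1e.
  by rewrite Qg add0r Qa -EFinM -expRD subrr expR0.
have le1 A : measurable A -> (forall x, A x -> g x <= 1) -> (Q' A <= Q A)%E.
  move=> mA gA; rewrite Q'E /density -[leRHS]mul1e -integral_cst//.
  apply: ge0_le_integral => //.
  - by move=> x _; rewrite lee_fin.
  - by apply: measurable_funTS; exact/measurable_EFinP.
have ge1 A : measurable A -> (forall x, A x -> 1 <= g x) -> (Q A <= Q' A)%E.
  move=> mA gA; rewrite Q'E /density -[leLHS]mul1e -integral_cst//.
  apply: ge0_le_integral => //.
  by apply: measurable_funTS; exact/measurable_EFinP.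
have setC_le (P1 P2 : probability R R) y :
    (P1 `]y, +oo[%classic <= P2 `]y, +oo[%classic)%E ->
    (P2 `]-oo, y]%classic <= P1 `]-oo, y]%classic)%E.
  by move=> h; rewrite -setCitvr !probability_setC// leeB.
exists Q'; split.
- move=> s; rewrite -Qg -(ge0_integral_density _ mg g0)//.
  + by apply: eq_measure_integral => A _ _; exact: Q'E.
  + by apply/measurable_EFinP; exact: measurable_expRM.
- move=> a0 y; have gm x z : x <= z -> g x <= g z.
    by move=> xz; rewrite ler_wpM2r ?expR_ge0// ler_expR ler_wpM2l.
  have [gy|gy] := leP (g y) 1.
    by apply: le1 => // x; rewrite /= in_itv/= => /gm /le_trans; apply.
  apply: setC_le; apply: ge1 => // x; rewrite /= in_itv/= andbT => /ltW/gm.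
  exact/le_trans/ltW.
- move=> a0 y; have gm x z : x <= z -> g z <= g x.
    by move=> xz; rewrite ler_wpM2r ?expR_ge0// ler_expR ler_wnM2l.
  have [gy|gy] := leP 1 (g y).
    by apply: ge1 => // x; rewrite /= in_itv/= => /gm; exact: le_trans.
  apply: setC_le; apply: le1 => // x; rewrite /= in_itv/= andbT => /ltW/gm /le_trans.
  by apply; exact: ltW.
Qed.

End tilt.

(** * Exponential dispersion families *)

Lemma mgf_ge_mean (R : realType) (Q : probability R R) (s c : R) :
  Q.-integrable setT (EFin \o (fun x => x)) -> mgf Q s = (expR c)%:E ->
  s * \int[Q]_x x <= c /\
  (c = s * \int[Q]_x x -> s != 0 -> Q (~` [set \int[Q]_x x]) = 0%E).
Proof.
move=> ix Qs; set m := \int[Q]_x x.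
pose f x : R := expR (- (s * m)) * expR (s * x) - (1 - s * m + s * x).
have fE x : f x = expR (s * (x - m)) - (1 + s * (x - m)).
  by rewrite /f -expRD; congr (expR _ - _); ring.
have f0 x : 0 <= f x by rewrite fE subr_ge0 expR_ge1Dx.
have i0 : Q.-integrable setT (EFin \o (fun x => expR (s * x))).
  by apply: integrable_mgf; rewrite Qs ltry.
have i1 : Q.-integrable setT (EFin \o (fun x => expR (- (s * m)) * expR (s * x))).
  exact: (integrableZl measurableT (expR (- (s * m))) i0).
have i2 : Q.-integrable setT (EFin \o (fun x => s * x)).
  exact: (integrableZl measurableT s ix).
have i3 : Q.-integrable setT (EFin \o (fun=> 1 - s * m)).
  exact: (finite_measure_integrable_cst Q).
have i4 : Q.-integrable setT (EFin \o (fun x => 1 - s * m + s * x)).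
  exact: (integrableD measurableT i3 i2).
have i5 : Q.-integrable setT (EFin \o f) by exact: (integrableB measurableT i1 i4).
have If : \int[Q]_x f x = expR (c - s * m) - 1.
  rewrite /f RintegralB// RintegralD// !RintegralZl// -/m Rintegral_cst//.
  rewrite [fine _](_ : _ = 1) ?mulr1 ?subrK; last by exact: (congr1 fine (probability_setT Q)).
  by rewrite /Rintegral -/(mgf Q s) Qs/= -expRD [- _ + c]addrC.
split.
  have : 0 <= \int[Q]_x f x by exact: Rintegral_ge0.
  by rewrite If subr_ge0 -[leLHS]expR0 ler_expR subr_ge0.
move=> cs s0.
have If0 : (\int[Q]_x (f x)%:E = 0)%E.
  have E : \int[Q]_x f x = 0 by rewrite If cs subrr expR0 subrr.
  have Efin : (\int[Q]_x (f x)%:E)%E \is a fin_num by exact: integrable_fin_num i5.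
  by rewrite -(fineK Efin) -/(Rintegral Q setT f) E.
have mf : measurable_fun setT (EFin \o f) by case/integrableP: i5.
have /(ae_eq_integral_abs Q measurableT mf) : (\int[Q]_x `|(EFin \o f) x| = 0)%E.
  by under eq_integral do rewrite gee0_abs ?lee_fin//.
move=> [N [mN N0 fN]]; apply/eqP; rewrite -measure_le0 -N0.
apply: le_measure; rewrite ?inE//; first by apply: measurableC; exact: measurable_set1.
move=> x xm; apply: fN => /(_ I) /eqP; rewrite eqe fE subr_eq0 => /eqP.
apply/eqP; rewrite gt_eqF// expR_gt1Dx// mulf_neq0// subr_eq0.
by apply/eqP.
Qed.

Section natural_law.
Context (R : realType) (kappa : R -> R) (Theta : set R).
Implicit Types (theta w t : R) (Q A B : probability R R).

(* The law of [w * Y] when [Y] follows EDF(theta, v, phi) with [w = v / phi]. *)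
Definition nat_law theta w Q := forall t,
  (Theta t <-> (mgf Q (t - theta) < +oo)%E) /\
  (Theta t -> mgf Q (t - theta) = (expR (w * (kappa t - kappa theta)))%:E).

Lemma interior_near theta : Theta° theta ->
  exists2 e, 0 < e & forall s, `|s| < e -> Theta (theta + s).
Proof.
move=> /nbhs_ballP[e /= e0 He]; exists e => // s se; apply: He.
by rewrite /ball/= opprD addrA subrr add0r normrN.
Qed.

Lemma nat_law_near theta w Q : Theta° theta -> nat_law theta w Q ->
  exists2 e, mgf_near Q e & forall s, `|s| < e -> Theta (theta + s).
Proof.
move=> /interior_near[e e0 He] HQ; exists e => //; split=> // s se.
by have [/proj1/(_ (He s se))] := HQ (theta + s); rewrite addrAC subrr add0r.
Qed.

Lemma nat_law_unique theta w Q1 Q2 : Theta° theta ->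
  nat_law theta w Q1 -> nat_law theta w Q2 ->
  forall C, measurable C -> Q1 C = Q2 C.
Proof.
move=> it H1 H2; have [e [e0 Qe] He] := nat_law_near it H1.
apply: (mgf_unique e0 Qe) => s se.
have Ts := He s se; have E : theta + s - theta = s by rewrite addrAC subrr add0r.
have [_ /(_ Ts)] := H1 (theta + s); have [_ /(_ Ts)] := H2 (theta + s).
by rewrite E => -> ->.
Qed.

Lemma nat_law_tilt theta w t Q : Theta t -> nat_law theta w Q ->
  exists Q', [/\ nat_law t w Q', theta <= t -> stle Q Q' & t <= theta -> stle Q' Q].
Proof.
move=> Tt HQ; have [_ /(_ Tt) /exponential_tilt[Q' [Q'm h1 h2]]] := HQ t.
exists Q'; split; [|by move=> h; apply: h1; rewrite subr_ge0
  |by move=> h; apply: h2; rewrite subr_le0].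
move=> u; rewrite Q'm subrKA; have [[H1 H2] H3] := HQ u; split; [split|].
- by move=> /H3 ->; rewrite -EFinM ltry.
- move=> h; apply: H2; rewrite ltNge; apply/negP; rewrite leye_eq => /eqP E.
  by move: h; rewrite E gt0_mulye// lte_fin expR_gt0.
- by move=> /H3 ->; rewrite -EFinM -expRD; congr (expR _)%:E; ring.
Qed.

Lemma nat_law_conv theta w1 w2 A B : nat_law theta w1 A -> nat_law theta w2 B ->
  nat_law theta (w1 + w2) (conv A B).
Proof.
move=> HA HB t; rewrite mgf_conv.
have [[A1 A2] A3] := HA t; have [[B1 B2] B3] := HB t; split; [split|].
- by move=> Tt; rewrite A3// B3// -EFinM ltry.
- move=> h; apply: contrapT => nT.
  have Ay : mgf A (t - theta) = +oo%E.
    by apply/eqP; rewrite -leye_eq leNgt; apply/negP => /A2.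
  have By : mgf B (t - theta) = +oo%E.
    by apply/eqP; rewrite -leye_eq leNgt; apply/negP => /B2.
  by move: h; rewrite Ay By.
- by move=> Tt; rewrite A3// B3// -EFinM -expRD mulrDl.
Qed.

Lemma nat_law_mean theta w Q : 0 < w -> Theta° theta -> nat_law theta w Q ->
  Q.-integrable setT (EFin \o (fun x => x)) /\
  \int[Q]_x x = w * derive1 kappa theta.
Proof.
move=> w0 it HQ; have [e Qe He] := nat_law_near it HQ.
have e0 : `|0 : R| < e by rewrite normr0; case: Qe.
have x1E : (fun x : R => x ^+ 1 * expR (0 * x)) = (fun x => x).
  by apply/funext => x; rewrite mul0r expR0 mulr1.
have := integrable_monexp 1 Qe e0; rewrite x1E => ix; split => //.
pose M s := \int[Q]_x (x ^+ 0 * expR (s * x)).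
have ME s : `|s| < e -> M s = expR (w * (kappa (theta + s) - kappa theta)).
  move=> se; rewrite /M /Rintegral; under eq_integral do rewrite expr0 mul1r.
  have [_ /(_ (He s se))] := HQ (theta + s).
  by rewrite addrAC subrr add0r /mgf => ->.
have dM : is_derive (0 : R) 1 M (\int[Q]_x x).
  by have := is_derive_mgf 0 Qe e0; rewrite x1E.
have M0 : M 0 = 1 by rewrite ME// addr0 subrr mulr0 expR0.
pose G t := kappa theta + w^-1 * ln (M (t - theta)).
have dG : is_derive theta 1 G (w^-1 * \int[Q]_x x).
  have dM' : is_derive (theta - theta) 1 M (\int[Q]_x x) by rewrite subrr.
  have dL : is_derive (M (theta - theta)) 1 (@ln R) ((M (theta - theta))^-1).
    by apply: is_derive1_ln; rewrite subrr M0.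
  have dS : is_derive theta 1 (fun t : R => t - theta) 1.
    by apply: is_derive_eq; rewrite subr0.
  have dMS := @is_derive1_comp R M (fun t => t - theta) theta _ _ dM' dS.
  have dLM := @is_derive1_comp R (@ln R) (M \o (fun t => t - theta)) theta _ _ dL dMS.
  rewrite /G; apply: is_derive_eq.
  by rewrite /GRing.scale/= subrr M0 invr1; ring.
suff -> : derive1 kappa theta = w^-1 * \int[Q]_x x by rewrite mulrA divff ?mul1r// gt_eqF.
rewrite derive1E -(derive_val (is_derive := dG)); apply: near_eq_derive.
near=> t; rewrite /G ME; last first.
  near: t; apply/nbhs_ballP; exists e => /= [|t]; first by case: Qe.
  by rewrite /ball/= distrC.
have -> : theta + (t - theta) = t by rewrite addrC subrK.
by rewrite expRK mulrA mulVf ?gt_eqF// mul1r [RHS]addrC subrK.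
Unshelve. all: by end_near. Qed.

Lemma nat_law_mean_lt theta w t Q : 0 < w -> Theta° theta -> Theta° t ->
  nat_law theta w Q -> (forall c, Q (~` [set c]) != 0%E) -> t != theta ->
  0 < (t - theta) * (derive1 kappa t - derive1 kappa theta).
Proof.
move=> w0 itheta it HQ nd tt.
have Tt : Theta t by exact: interior_subset.
have Ttheta : Theta theta by exact: interior_subset.
have [Q' [HQ' _ _]] := nat_law_tilt Tt HQ.
have [ix mx] := nat_law_mean w0 itheta HQ.
have [ix' mx'] := nat_law_mean w0 it HQ'.
have [_ /(_ Tt) /(mgf_ge_mean ix)] := HQ t; rewrite mx => -[h1 h2].
have [_ /(_ Ttheta) /(mgf_ge_mean ix')[]] := HQ' theta; rewrite mx' => h3 _.
have h4 : (t - theta) * (w * derive1 kappa theta) < w * (kappa t - kappa theta).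
  rewrite lt_neqAle h1 andbT; apply/negP => /eqP /esym/h2.
  by rewrite subr_eq0 => /(_ tt) /eqP; apply/negP/nd.
rewrite -(pmulr_rgt0 _ w0); lra.
Qed.

End natural_law.

Section edf_natural.
Context (R : realType) (kappa : R -> R) (Theta : set R).
Variables (theta v phi : R).
Hypotheses (v0 : 0 < v) (phi0 : 0 < phi).
Let w := v / phi.

Let w0 : 0 < w. Proof. exact: divr_gt0. Qed.

Let wE y : (y * theta - kappa theta) / (phi / v) = w * (y * theta - kappa theta).
Proof. by rewrite invf_div mulrC. Qed.

Let mulw (y : R) : R := w * y.
Let divw (x : R) : R := x / w.

Let mmulw : measurable_fun setT mulw. Proof. exact: measurable_funM. Qed.
Let mdivw : measurable_fun setT divw. Proof. exact: measurable_funM. Qed.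

HB.instance Definition _ := isMeasurableFun.Build _ _ _ _ mulw mmulw.
HB.instance Definition _ := isMeasurableFun.Build _ _ _ _ divw mdivw.

Let mlin (a b : R) : measurable_fun setT (fun y : R => expR (a * (y * theta - b))).
Proof.
apply: measurableT_comp => //; apply: measurable_funM => //.
by apply: measurable_funB => //; exact: measurable_funM.
Qed.

Lemma EDF_law_nat (Q : set R -> \bar R) : EDF_law kappa Theta theta v phi Q ->
  exists Qn : probability R R, [/\ nat_law kappa Theta theta w Qn,
    forall A, measurable A -> Q A = Qn ((fun x => x / w) @^-1` A) &
    assumption_A1 kappa Theta -> forall c, Qn (~` [set c]) != 0%E].
Proof.
move=> [Tt [nu [dnu QE]]].
pose g (y : R) := expR (w * (y * theta - kappa theta)).
have mg : measurable_fun setT g by exact: mlin.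
have g0 y : 0 <= g y by exact: expR_ge0.
have tiltE t : (\int[nu]_y ((expR (w * y * (t - theta)))%:E * (g y)%:E) =
    (expR (- (w * kappa theta)))%:E * \int[nu]_y (expR (w * y * t))%:E)%E.
  rewrite -ge0_integralZl//; last first.
    apply/measurable_EFinP; apply: measurableT_comp => //.
    by apply: measurable_funM => //; exact: measurable_funM.
  apply: eq_integral => y _; rewrite -!EFinM /g -!expRD; congr (expR _)%:E; ring.
have [_ /(_ Tt) dtt] := dnu theta.
have /probability_of_measure[Qp QpE] : density nu mg g0 setT = 1%E.
  rewrite /density; transitivity (\int[nu]_y ((expR (w * y * (theta - theta)))%:E * (g y)%:E))%E.
    by apply: eq_integral => y _; rewrite subrr mulr0 expR0 mul1e.
  by rewrite tiltE dtt -EFinM -expRD addNr expR0.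
exists (distribution Qp mulw); split.
- have mE t : mgf (distribution Qp mulw) (t - theta) =
    ((expR (- (w * kappa theta)))%:E * \int[nu]_y (expR (w * y * t))%:E)%E.
    rewrite mgf_distribution -tiltE -(ge0_integral_density _ mg g0)//; last first.
      apply/measurable_EFinP; apply: measurableT_comp => //.
      by apply: measurable_funM => //; exact: measurable_funM.
    transitivity (\int[Qp]_y (expR (w * y * (t - theta)))%:E)%E.
      by apply: eq_integral => y _; rewrite /mulw mulrC.
    by apply: eq_measure_integral => A _ _; exact: QpE.
  move=> t; rewrite mE; have [[d1 d2] d3] := dnu t; split; [split|].
  + by move=> /d3 ->; rewrite -EFinM ltry.
  + move=> h; apply: d2; rewrite ltNge; apply/negP; rewrite leye_eq => /eqP E.
    by move: h; rewrite E gt0_muley// lte_fin expR_gt0.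
  + by move=> /d3 ->; rewrite -EFinM -expRD; congr (expR _)%:E; rewrite mulrBr addrC.
- move=> A mA; rewrite QE//.
  have pE : mulw @^-1` ((fun x => x / w) @^-1` A) = A.
    by apply/seteqP; split => y /=; rewrite /mulw [w * y]mulrC mulfK// gt_eqF.
  transitivity (Qp A); last exact: (congr1 Qp (esym pE)).
  by rewrite QpE /density; apply: eq_integral => y _; rewrite wE.
- move=> [_ A1] c; apply/negP => /eqP E.
  apply: (A1 w nu w0 dnu); exists (c / w).
  have mC : measurable (~` [set c / w]) by apply: measurableC; exact: measurable_set1.
  have pE : mulw @^-1` (~` [set c]) = ~` [set c / w].
    apply/seteqP; split => y /= h k; apply: h; rewrite /mulw.
      by rewrite k mulrC divfK// gt_eqF.
    by rewrite -k /mulw mulrC mulKf// gt_eqF.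
  have {}E : (\int[nu]_(x in ~` [set (c / w)%R]) (g x)%:E = 0)%E.
    by rewrite -E -[LHS]QpE; exact: (congr1 Qp (esym pE)).
  have mgC : measurable_fun (~` [set c / w]) (EFin \o g).
    by apply: measurable_funTS; exact/measurable_EFinP.
  have /(ae_eq_integral_abs nu mC mgC) : (\int[nu]_(x in ~` [set (c / w)%R]) `|(EFin \o g) x| = 0)%E.
    by under eq_integral do rewrite gee0_abs ?lee_fin//.
  move=> [N [mN N0 fN]]; apply/eqP; rewrite -measure_le0 -N0.
  apply: le_measure; rewrite ?inE//.
  move=> x xm; apply: fN => /(_ xm) /eqP; rewrite eqe.
  by rewrite /g expR_eq0.
Qed.

Lemma nat_law_EDF (Qn : probability R R) : Theta theta ->
  nat_law kappa Theta theta w Qn ->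
  EDF_law kappa Theta theta v phi (fun A => Qn ((fun x => x / w) @^-1` A)).
Proof.
move=> Tt HQ; split => //.
pose g (y : R) := expR (- w * (y * theta - kappa theta)).
have mg : measurable_fun setT g by exact: mlin.
have g0 y : 0 <= g y by exact: expR_ge0.
pose Qp : probability R R := distribution Qn divw.
exists (density Qp mg g0); split.
- have dE t : (\int[density Qp mg g0]_y (expR (w * y * t))%:E =
      (expR (w * kappa theta))%:E * mgf Qn (t - theta))%E.
    have mt u : measurable_fun setT (fun y : R => expR (w * y * u)).
      apply: measurableT_comp => //.
      by apply: measurable_funM => //; exact: measurable_funM.
    rewrite ge0_integral_density//; last exact/measurable_EFinP.
    rewrite /mgf -ge0_integralZl//; last by apply/measurable_EFinP; exact: measurable_expRM.
    rewrite ge0_integral_distribution//; last first.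
    + by move=> y; rewrite -EFinM lee_fin mulr_ge0 ?expR_ge0.
    + by apply/measurable_EFinP; exact: measurable_funM.
    apply: eq_integral => x _; rewrite /= -!EFinM /g -!expRD /divw.
    by congr (expR _)%:E; rewrite [w * (x / w)]mulrC divfK ?gt_eqF//;
       rewrite mulNr mulrBr mulrA [w * (x / w)]mulrC divfK ?gt_eqF//; ring.
  move=> t; rewrite dE; have [[d1 d2] d3] := HQ t; split; [split|].
  + by move=> /d3 ->; rewrite -EFinM ltry.
  + move=> h; apply: d2; rewrite ltNge; apply/negP; rewrite leye_eq => /eqP E.
    by move: h; rewrite E gt0_muley// lte_fin expR_gt0.
  + by move=> /d3 ->; rewrite -EFinM -expRD; congr (expR _)%:E; rewrite mulrBr addrC subrK.
- move=> A mA; rewrite integral_mkcond.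
  have mf : measurable_fun setT ((fun y : R =>
      (expR ((y * theta - kappa theta) / (phi / v)))%:E) \_ A).
    apply/(measurable_restrictT _ mA); apply: measurable_funTS.
    by apply/measurable_EFinP; under eq_fun do rewrite wE; exact: mlin.
  rewrite ge0_integral_density//; last first.
    by move=> y; apply: erestrict_ge0 => z _; rewrite lee_fin expR_ge0.
  transitivity (\int[Qp]_y (\1_A y)%:E)%E; first by rewrite integral_indic// setIT.
  apply: eq_integral => y _; rewrite patchE indicE; case: ifPn => _; last by rewrite mul0e.
  by rewrite -EFinM wE /g -expRD mulNr subrr expR0.
Qed.

End edf_natural.

(** * Half-lines and independence *)

Section down_closed.
Context (R : realType).
Implicit Types (D : set R) (A B : probability R R).

Definition down_closed D := forall x y : R, x <= y -> D y -> D x.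

Lemma down_closed_seq D : down_closed D -> D !=set0 ->
  exists u : nat -> R, [/\ nondecreasing_seq u, forall n, D (u n) &
    D = \bigcup_n `]-oo, u n]%classic].
Proof.
move=> dD D0.
suff [u [u1 u2 u3]] : exists u : nat -> R, [/\ nondecreasing_seq u, forall n, D (u n) &
    forall x, D x -> exists n, x <= u n].
  exists u; split => //; apply/seteqP; split => x.
    by move=> /u3[n xn]; exists n => //=; rewrite in_itv.
  by move=> [n _]; rewrite /= in_itv/= => /dD; apply.
have [hs|hs] := pselect (has_sup D); last first.
  exists (fun n => n%:R); split.
  - by move=> m n mn; rewrite ler_nat.
  - move=> n; apply: contrapT => nD; apply: hs; split => //; exists n%:R => x Dx.
    by rewrite leNgt; apply/negP => /ltW nx; apply: nD; exact: dD Dx.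
  - by move=> x _; exists (Num.truncn x).+1; rewrite ltW// truncnS_gt.
have [sD|sD] := pselect (D (sup D)).
  by exists (fun=> sup D); split => // x Dx; exists 0%N; exact: sup_ubound (hs.2) _ Dx.
exists (fun n => sup D - n.+1%:R^-1); split.
- by move=> m n mn; rewrite lerB// lef_pV2 ?posrE// ler_nat.
- move=> n; have n0 : 0 < n.+1%:R^-1 :> R by rewrite invr_gt0.
  have [x Dx] := sup_adherent n0 hs.
  by move=> /ltW h; exact: dD h Dx.
- move=> x Dx; have xs : x < sup D.
    rewrite lt_neqAle; apply/andP; split; last exact: sup_ubound (hs.2) _ Dx.
    by apply/eqP => E; apply: sD; rewrite -E.
  have [k hk] := ltr_add_invr xs; exists k; rewrite lerBrDr; exact: ltW.
Qed.

Lemma down_closed_measurable D : down_closed D -> measurable D.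
Proof.
move=> dD; have [->//|/set0P D0] := eqVneq D set0.
by have [u [_ _ ->]] := down_closed_seq dD D0; apply: bigcup_measurable.
Qed.

Lemma down_closed_cvg D : down_closed D -> D !=set0 -> exists u : nat -> R,
  (forall n, D (u n)) /\
  forall A, A `]-oo, u n]%classic @[n --> \oo] --> A D.
Proof.
move=> dD D0; have [u [u1 u2 u3]] := down_closed_seq dD D0.
exists u; split=> // A; rewrite [X in _ --> A X]u3.
apply: nondecreasing_cvg_mu => //; first exact: bigcup_measurable.
move=> m n mn; apply/subsetPset => x /=; rewrite !in_itv/= => /le_trans.
by apply; exact: u1.
Qed.

Lemma down_closed_le A D (c : \bar R) : down_closed D -> (0 <= c)%E ->
  (forall u, D u -> (A `]-oo, u]%classic <= c)%E) -> (A D <= c)%E.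
Proof.
move=> dD c0 h; have [->|/set0P D0] := eqVneq D set0; first by rewrite measure0.
have [u [u1 /(_ A) u2]] := down_closed_cvg dD D0.
by rewrite -(cvg_lim _ u2)//; apply: lime_le; [apply/cvg_ex; exists (A D)|by apply: nearW => n; apply: h].
Qed.

Lemma stle_down_closed A B D : stle A B -> down_closed D -> (B D <= A D)%E.
Proof.
move=> AB dD; have [->|/set0P D0] := eqVneq D set0; first by rewrite !measure0.
have [u [u1 u2]] := down_closed_cvg dD D0.
apply: lee_cvg_to (u2 B) (u2 A) _; apply/nearW => n; exact: AB.
Qed.

Let negR (x : R) : R := - x.

Let negR_measurable : measurable_fun setT negR.
Proof. by apply: continuous_measurable_fun; exact: opp_continuous. Qed.

HB.instance Definition _ := isMeasurableFun.Build _ _ _ _ negR negR_measurable.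

Lemma up_closed_le A D (c : \bar R) : down_closed (~` D) -> (0 <= c)%E ->
  (forall u, D u -> (A `[u, +oo[%classic <= c)%E) -> (A D <= c)%E.
Proof.
move=> dD c0 h.
have -> : A D = distribution A negR (negR @^-1` D).
  apply: (congr1 A); apply/seteqP.
  by split => x /=; rewrite /negR opprK.
apply: down_closed_le => //.
  move=> x y xy /= Dy; apply: contrapT => nD; move: (Dy).
  by apply: (dD (negR y) (negR x)) => //; rewrite lerN2.
move=> u /= Du; rewrite [leLHS](_ : _ = A `[negR u, +oo[%classic); first exact: h.
apply: (congr1 A); apply/seteqP.
by split => x /=; rewrite !in_itv/= andbT /negR; [rewrite lerNl|rewrite lerNl].
Qed.

End down_closed.

Section independence.
Context d (T : measurableType d) (R : realType) (P : probability T R).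
Variables (n : nat) (Y : 'I_n -> {RV P >-> R}).
Hypothesis indY : mutually_independent P (fun i => (Y i : T -> R)).

Let mfY (f : R -> R) i : measurable_fun setT f -> measurable_fun setT (fun x => f (Y i x)).
Proof. by move=> mf; apply: measurableT_comp. Qed.

Lemma independent_expectation (f : 'I_n -> R -> R) :
  (forall i, measurable_fun setT (f i)) -> (forall i y, 0 <= f i y) ->
  (forall i, (\int[P]_x (f i (Y i x))%:E < +oo)%E) ->
  (\int[P]_x (\prod_(i < n) f i (Y i x))%:E =
   \prod_(i < n) \int[P]_x (f i (Y i x))%:E)%E.
Proof.
move=> mf f0 fy.
suff H m : forall f : 'I_n -> R -> R,
    (forall i, measurable_fun setT (f i)) -> (forall i y, 0 <= f i y) ->
    (forall i, (\int[P]_x (f i (Y i x))%:E < +oo)%E) ->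
    (forall i : 'I_n, (m <= i)%N -> exists2 B, measurable B & f i = \1_B) ->
    (\int[P]_x (\prod_(i < n) f i (Y i x))%:E =
     \prod_(i < n) \int[P]_x (f i (Y i x))%:E)%E.
  by apply: (H n) => // i; rewrite leqNgt ltn_ord.
elim: m => [|m IH] {mf f0 fy}f mf f0 fy fB.
  have /choice[B mBf] i : exists b : set R, measurable b /\ f i = \1_b.
    by have [b mb fb] := fB i (leq0n i); exists b.
  have mYB i : measurable (Y i @^-1` B i).
    by rewrite -[X in measurable X]setTI; apply: measurable_funP => //; case: (mBf i).
  transitivity (P (\bigcap_(i in [set: 'I_n]) (Y i @^-1` B i))).
    rewrite -[X in P X]setIT -integral_indic//; last first.
      by apply: fin_bigcap_measurable.
    apply: eq_integral => x _; congr (_%:E).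
    rewrite indicE; have [xB|xB] := boolP (x \in _).
      rewrite big1// => i _; rewrite (mBf i).2 indicE mem_set//.
      by move: xB; rewrite inE => /(_ i I).
    move: xB; rewrite notin_setE => xB.
    have /existsNP[i /not_implyP[_ xi]] := xB.
    by rewrite (bigD1 i)//= (mBf i).2 indicE memNset// mul0r.
  rewrite indY; last by move=> i; case: (mBf i).
  apply: eq_bigr => i _; rewrite -[X in P X]setIT -integral_indic//.
  by apply: eq_integral => x _; rewrite (mBf i).2.
have [mn|nm] := ltnP m n; last first.
  apply: IH => // i mi; have := leq_trans nm mi; by rewrite leqNgt ltn_ord.
pose i0 := Ordinal mn.
pose g x := \prod_(i < n | i != i0) f i (Y i x).
have mg : measurable_fun setT g.
  have -> : g = fun x => \prod_(i <- [seq i <- index_enum 'I_n | i != i0]) f i (Y i x).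
    by apply/funext => x; rewrite big_filter.
  by apply: (@measurable_prod _ _ _ _ _ _ (fun i x => f i (Y i x))) => i _; exact: mfY.
have g0 x : 0 <= g x by exact: prodr_ge0.
pose c := (\prod_(i < n | i != i0) \int[P]_x (f i (Y i x))%:E)%E.
have c0 : (0 <= c)%E by apply: prode_ge0 => i _; apply: integral_ge0 => x _; rewrite lee_fin.
have cfin : c \is a fin_num.
  apply: prode_fin_num => i _; rewrite ge0_fin_numE//.
  by apply: integral_ge0 => x _; rewrite lee_fin.
have fc0 : 0 <= fine c by exact: fine_ge0.
transitivity (\int[P]_x ((f i0 (Y i0 x))%:E * (g x)%:E))%E.
  by apply: eq_integral => x _; rewrite -EFinM (bigD1 i0).
rewrite -(ge0_integral_density _ mg g0); last 2 first.
- by apply/measurable_EFinP; exact: mfY.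
- by move=> x; rewrite lee_fin.
rewrite -(@ge0_integral_pushforward _ _ _ _ _ (Y i0) _ (density P mg g0) setT (fun y => (f i0 y)%:E))//; last 2 first.
- exact/measurable_EFinP.
- by move=> y _; rewrite lee_fin.
rewrite (bigD1 i0)//= -/c muleC -(fineK cfin).
have -> : (\int[P]_x (f i0 (Y i0 x))%:E = \int[distribution P (Y i0)]_y (f i0 y)%:E)%E.
  by rewrite ge0_integral_distribution//; [exact/measurable_EFinP|move=> y; rewrite lee_fin].
rewrite -(@ge0_integral_mscale _ _ _ _ _ _ (NngNum fc0))//; last 2 first.
- exact/measurable_EFinP.
- by move=> y _; rewrite lee_fin.
apply: eq_measure_integral => B mB _.
rewrite /pushforward /mscale/= /distribution /pushforward.
pose f' i := if i == i0 then \1_B else f i.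
have f'i0 : f' i0 = \1_B by rewrite /f' eqxx.
have f'i i : i != i0 -> f' i = f i by rewrite /f' => /negbTE ->.
have mYB : measurable (Y i0 @^-1` B).
  by rewrite -[X in measurable X]setTI; apply: measurable_funP.
have IB : (\int[P]_x (\1_B (Y i0 x))%:E = P (Y i0 @^-1` B))%E.
  by rewrite -[X in P X]setIT -integral_indic.
have key : (\int[P]_x (\prod_(i < n) f' i (Y i x))%:E = (fine c)%:E * P (Y i0 @^-1` B))%E.
  rewrite IH.
  - rewrite (bigD1 i0)//= f'i0 IB fineK// muleC; congr (_ * _)%E.
    by apply: eq_bigr => i /f'i ->.
  - by move=> i; rewrite /f'; case: ifP.
  - by move=> i y; rewrite /f'; case: ifP.
  - move=> i; rewrite /f'; case: ifP => [/eqP ->|_]; last exact: fy.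
    by rewrite IB (le_lt_trans (probability_le1 _ _)) ?ltry.
  - move=> i mi; have [->|ii0] := eqVneq i i0; first by exists B.
    rewrite f'i//; apply: fB; rewrite ltn_neqAle mi andbT eq_sym.
    by apply: contra ii0 => /eqP E; apply/eqP/val_inj.
rewrite [RHS](_ : _ = \int[P]_x (\prod_(i < n) f' i (Y i x))%:E)%E; last by rewrite key.
rewrite /density integral_mkcond; apply: eq_integral => x _.
rewrite (bigD1 i0)//= f'i0 patchE indicE/=.
rewrite (_ : (x \in _) = (Y i0 x \in B)); last by apply/idP/idP; rewrite !inE.
rewrite (eq_bigr (fun i => f i (Y i x))); last by move=> i /f'i ->.
by case: ifPn => _; rewrite ?mul1r ?mul0r.
Qed.

End independence.

(** * Coverage *)

Section iterated_convolution.
Context (R : realType) (I : eqType).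
Implicit Types (L : I -> probability R R) (i : I) (r : seq I).

Fixpoint convs L i r : probability R R :=
  if r is j :: r' then conv (L i) (convs L j r') else L i.

Lemma mgf_convs L i r s : mgf (convs L i r) s = (\prod_(k <- i :: r) mgf (L k) s)%E.
Proof.
elim: r i => [|j r IH] i; first by rewrite big_seq1.
by rewrite big_cons -IH -mgf_conv.
Qed.

Lemma nat_law_convs kappa Theta theta (w : I -> R) L i r :
  (forall k, nat_law kappa Theta theta (w k) (L k)) ->
  nat_law kappa Theta theta (\sum_(k <- i :: r) w k) (convs L i r).
Proof.
move=> HL; elim: r i => [|j r IH] i; first by rewrite big_seq1.
by rewrite big_cons; exact: nat_law_conv.
Qed.

Lemma stle_convs L L' i r :
  {in i :: r, forall k, stle (L k) (L' k)} -> stle (convs L i r) (convs L' i r).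
Proof.
elim: r i => [|j r IH] i h; first by apply: h; rewrite mem_head.
apply: stle_conv; first by apply: h; rewrite mem_head.
by apply: IH => k kr; apply: h; rewrite inE kr orbT.
Qed.

End iterated_convolution.

Section law_of_edf.
Context (R : realType) (kappa : R -> R) (Theta : set R) (phi : R).
Hypothesis phi0 : 0 < phi.

Definition mulby (a x : R) : R := x * a.

Let measurable_mulby a : measurable_fun setT (mulby a).
Proof. exact: measurable_funM. Qed.

HB.instance Definition _ a := isMeasurableFun.Build _ _ _ _ (mulby a) (measurable_mulby a).

Lemma EDF_lawof_nat t v (C : probability R R) : 0 < v -> Theta° t ->
  nat_law kappa Theta t (v / phi) C -> forall A, measurable A ->
  EDF_lawof kappa Theta t v phi A = C ((fun x => x / (v / phi)) @^-1` A).
Proof.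
move=> v0 it HC A mA; rewrite /EDF_lawof; case: pselect => [ex|[]]; last first.
  exists (fun A => C ((fun x => x / (v / phi)) @^-1` A)).
  by apply: nat_law_EDF => //; exact: interior_subset.
have [Qn [HQn QnE _]] := EDF_law_nat v0 phi0 (projT2 (cid ex)).
rewrite QnE//; apply: (nat_law_unique it HQn HC).
have := measurable_mulby (v / phi)^-1 measurableT mA.
by rewrite setTI.
Qed.

Lemma EDF_lawof_le t v (A B : set R) : measurable A -> measurable B -> A `<=` B ->
  (EDF_lawof kappa Theta t v phi A <= EDF_lawof kappa Theta t v phi B)%E.
Proof.
move=> mA mB AB; rewrite /EDF_lawof; case: pselect => [ex|//].
have [_ [nu [_ QE]]] := projT2 (cid ex).
rewrite !QE//; apply: ge0_subset_integral => //.
apply: measurable_funTS; apply/measurable_EFinP; apply: measurableT_comp => //.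
by apply: measurable_funM => //; apply: measurable_funB => //; exact: measurable_funM.
Qed.

Lemma EDF_l_le delta v y y' : y <= y' ->
  (EDF_l kappa Theta delta y v phi <= EDF_l kappa Theta delta y' v phi)%E.
Proof.
move=> yy'; apply: ereal_inf_le_tmp => _ [m [mm hm] <-]; exists m => //; split => //.
apply: le_trans hm; apply: EDF_lawof_le => //.
by move=> x /=; rewrite !in_itv/= => /lt_le_trans; apply.
Qed.

Lemma EDF_u_le delta v y y' : y <= y' ->
  (EDF_u kappa Theta delta y v phi <= EDF_u kappa Theta delta y' v phi)%E.
Proof.
move=> yy'; apply: ereal_sup_le => _ [m [mm hm] <-]; exists m => //; split => //.
apply: (le_trans hm); apply: EDF_lawof_le => //.
by move=> x /=; rewrite !in_itv/= => /le_trans; apply.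
Qed.

Lemma EDF_h_derive1 theta v Q : 0 < v -> Theta° theta ->
  assumption_A1 kappa Theta -> EDF_law kappa Theta theta v phi Q ->
  EDF_h kappa Theta (derive1 kappa theta) = theta.
Proof.
move=> v0 it A1 HQ; rewrite /EDF_h; case: pselect => [ex|[]]; last by exists theta.
have [is_ E] := projT2 (cid ex); set s := projT1 _ in is_ E *.
have [Qn [HQn _ /(_ A1) nd]] := EDF_law_nat v0 phi0 HQ.
apply/eqP; apply: contrapT => /negP st.
have := nat_law_mean_lt (divr_gt0 v0 phi0) it is_ HQn nd st.
by rewrite E subrr mulr0 ltxx.
Qed.

Lemma derive1_kappa_le theta t v Q : 0 < v -> Theta° theta -> Theta° t ->
  assumption_A1 kappa Theta -> EDF_law kappa Theta theta v phi Q ->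
  (theta <= t -> derive1 kappa theta <= derive1 kappa t) /\
  (t <= theta -> derive1 kappa t <= derive1 kappa theta).
Proof.
move=> v0 itheta it A1 HQ; have [->//|st] := eqVneq t theta.
have [Qn [HQn _ /(_ A1) nd]] := EDF_law_nat v0 phi0 HQ.
have h := nat_law_mean_lt (divr_gt0 v0 phi0) itheta it HQn nd st.
split => ht; rewrite leNgt; apply/negP => hk; move: h; apply/negP; rewrite -leNgt.
  by rewrite mulr_ge0_le0 ?subr_ge0 ?subr_le0// ltW.
by rewrite mulr_le0_ge0 ?subr_ge0 ?subr_le0// ltW.
Qed.

Context d (T : measurableType d) (P : probability T R).

Lemma EDF_expectation theta v (Y : {RV P >-> R}) : 0 < v -> Theta° theta ->
  EDF_law kappa Theta theta v phi (distribution P Y) ->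
  ('E_P[Y] = (derive1 kappa theta)%:E)%E.
Proof.
move=> v0 it HQ; have [Qn [HQn QnE _]] := EDF_law_nat v0 phi0 HQ.
have w0 : 0 < v / phi by exact: divr_gt0.
set w := v / phi in w0 HQn QnE.
have [ix mx] := nat_law_mean w0 it HQn.
have DE (f : R -> \bar R) : (\int[distribution P Y]_y f y =
    \int[distribution Qn (mulby w^-1)]_y f y)%E.
  by apply: eq_measure_integral => A mA _; rewrite [LHS]QnE.
have iw : Qn.-integrable setT (EFin \o mulby w^-1).
  exact: (integrableZr measurableT w^-1 ix).
have iY : P.-integrable setT (EFin \o Y).
  apply/integrableP; split; first exact/measurable_EFinP.
  have /integrableP[_] := iw.
  rewrite -(@ge0_integral_distribution _ _ _ _ _ _ _ (fun y : R => `|y%:E|)%E)//; last first.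
    by apply: measurableT_comp => //; exact: measurableT_comp.
  rewrite -DE ge0_integral_distribution//.
  by apply: measurableT_comp => //; exact: measurableT_comp.
rewrite expectation_def.
rewrite -(@integral_distribution _ _ _ _ _ _ _ EFin)// DE integral_distribution//.
have -> : (\int[Qn]_x (EFin \o mulby w^-1) x = (\int[Qn]_x mulby w^-1 x)%:E)%E.
  by rewrite /Rintegral fineK//; exact: integrable_fin_num.
by rewrite /mulby RintegralZr// mx mulrC mulKf// gt_eqF.
Qed.

Lemma mgf_EDF (v : R) (Y : {RV P >-> R}) (Qn : probability R R) s :
  0 < v ->
  (forall A, measurable A -> distribution P Y A = Qn ((fun x => x / (v / phi)) @^-1` A)) ->
  mgf Qn s = (\int[P]_x (expR (s * (v / phi * Y x)))%:E)%E.
Proof.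
move=> v0 QnE; have w0 : 0 < v / phi by exact: divr_gt0.
set w := v / phi in w0 QnE *.
have mf : measurable_fun setT (fun y : R => (expR (s * (w * y)))%:E).
  apply/measurable_EFinP; apply: measurableT_comp => //.
  by apply: measurable_funM => //; exact: measurable_funM.
rewrite -(@ge0_integral_distribution _ _ _ _ _ _ Y (fun y : R => (expR (s * (w * y)))%:E))//.
transitivity (\int[distribution Qn (mulby w^-1)]_y (expR (s * (w * y)))%:E)%E.
  rewrite ge0_integral_distribution//; apply: eq_integral => x _ /=.
  by rewrite /mulby [w * _]mulrC divfK// gt_eqF.
by apply: eq_measure_integral => A mA _; rewrite [RHS]QnE.
Qed.

Context (n : nat) (Y : 'I_n -> {RV P >-> R}) (theta v : 'I_n -> R).
Hypotheses (v0 : forall i, 0 < v i) (itheta : forall i, Theta° (theta i)).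
Hypothesis indY : mutually_independent P (fun i => (Y i : T -> R)).
Hypothesis lawY : forall i, EDF_law kappa Theta (theta i) (v i) phi (distribution P (Y i)).

Lemma edf_sum_law (t : R) (D : pred 'I_n) j0 (S : {RV P >-> R}) : Theta° t -> D j0 ->
  (forall x, S x = \sum_(i < n | D i) v i / phi * Y i x) ->
  exists C' : probability R R,
  [/\ nat_law kappa Theta t ((\sum_(i < n | D i) v i) / phi) C',
      (forall i, D i -> t <= theta i) -> stle C' (distribution P S) &
      (forall i, D i -> theta i <= t) -> stle (distribution P S) C'].
Proof.
move=> it Dj0 SE.
have /choice[L HL] i : exists Qn : probability R R,
    nat_law kappa Theta (theta i) (v i / phi) Qn /\
    forall s, mgf Qn s = (\int[P]_x (expR (s * (v i / phi * Y i x)))%:E)%E.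
  have [Qn [h1 h2 _]] := EDF_law_nat (v0 i) phi0 (lawY i); exists Qn; split=> // s.
  exact: mgf_EDF.
have /choice[L' HL'] i : exists Q', [/\ nat_law kappa Theta t (v i / phi) Q',
    theta i <= t -> stle (L i) Q' & t <= theta i -> stle Q' (L i)].
  by apply: nat_law_tilt; [exact: interior_subset|exact: (HL i).1].
have /choice[E HE] i : exists e, 0 < e /\ forall s, `|s| < e -> (mgf (L i) s < +oo)%E.
  by have [e ? _] := nat_law_near (itheta i) (HL i).1; exists e.
pose e := \big[Order.min/1]_(i < n) E i.
have e0 : 0 < e by apply: lt_bigmin => // i _; case: (HE i).
have Le i s : `|s| < e -> (mgf (L i) s < +oo)%E.
  move=> se; apply: (HE i).2; apply: (lt_le_trans se); exact: bigmin_le.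
case Er : [seq i <- index_enum 'I_n | D i] => [|i r].
  have : j0 \in [seq i <- index_enum 'I_n | D i] by rewrite mem_filter Dj0 mem_index_enum.
  by rewrite Er.
have memr k : k \in i :: r -> D k by rewrite -Er mem_filter => /andP[].
have SC A : measurable A -> distribution P S A = convs L i r A.
  have mSC s : `|s| < e -> mgf (distribution P S) s = mgf (convs L i r) s.
    move=> se; rewrite mgf_distribution mgf_convs -Er big_filter.
    pose f k (y : R) := if D k then expR (s * (v k / phi * y)) else 1.
    transitivity (\int[P]_x (\prod_(k < n) f k (Y k x))%:E)%E.
      apply: eq_integral => x _; congr (_%:E).
      by rewrite SE mulr_sumr expR_sum big_mkcond.
    have fL k : (\int[P]_x (f k (Y k x))%:E = if D k then mgf (L k) s else 1)%E.
      rewrite /f (HL k).2; case: ifP => // _.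
      by rewrite integral_cst// mul1e; exact: probability_setT.
    rewrite (independent_expectation indY).
    - by rewrite [RHS]big_mkcond; apply: eq_bigr => k _; rewrite fL.
    - move=> k; rewrite /f; case: (D k) => //.
      apply: measurableT_comp => //.
      by apply: measurable_funM => //; exact: measurable_funM.
    - by move=> k y; rewrite /f; case: ifP => // _; exact: expR_ge0.
    - by move=> k; rewrite fL; case: ifP => _; [exact: Le|rewrite ltry].
  move=> mA; apply/esym; apply: (mgf_unique e0 _ _ mA) => [s se|s se]; last by rewrite mSC.
  rewrite mgf_convs; apply: (@lt_le_trans _ _ +oo%E) => //.
  rewrite -ge0_fin_numE; last by apply: prode_ge0 => k _; exact: mgf_ge0.
  by apply: prode_fin_num => k _; rewrite ge0_fin_numE ?Le// mgf_ge0.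
exists (convs L' i r); split.
- rewrite mulr_suml -big_filter Er; apply: nat_law_convs => k; by case: (HL' k).
- move=> h y; have := @stle_convs R _ L' L i r.
  move=> /(_ _ y); rewrite -SC//; apply => k /memr/h; by case: (HL' k).
- move=> h y; have := @stle_convs R _ L L' i r.
  move=> /(_ _ y); rewrite -SC//; apply => k /memr/h; by case: (HL' k).
Qed.

Lemma edf_coverage (t delta : R) (D : pred 'I_n) j0 : Theta° t -> D j0 -> 0 <= delta ->
  let V := \sum_(i < n | D i) v i in
  let Z x := V^-1 * \sum_(i < n | D i) v i * Y i x in
  let A := [set x | (EDF_F kappa Theta t V phi (Z x) < delta%:E)%E] in
  let B := [set x | ((1 - delta)%:E < EDF_Fs kappa Theta t V phi (Z x))%E] in
  [/\ measurable_fun setT Z,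
    (forall i, D i -> t <= theta i) -> measurable A /\ (P A <= delta%:E)%E &
    (forall i, D i -> theta i <= t) -> measurable B /\ (P B <= delta%:E)%E].
Proof.
move=> it Dj0 delta0 V Z A B.
have V0 : 0 < V.
  rewrite /V (bigD1 j0)//= ltr_pwDl// sumr_ge0// => i _; exact: ltW.
have W0 : 0 < V / phi by exact: divr_gt0.
have msum : measurable_fun setT (fun x => \sum_(i < n | D i) v i * Y i x).
  under eq_fun do rewrite -big_filter.
  by apply: (@measurable_sum _ _ _ _ _ _ (fun i x => v i * Y i x)) => i; exact: measurable_funM.
have mZ : measurable_fun setT Z by exact: measurable_funM.
pose S0 x := Z x * (V / phi).
have mS : measurable_fun setT S0 by exact: measurable_funM.
pose S : {RV P >-> R} := HB.pack S0 (isMeasurableFun.Build _ _ _ _ _ mS).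
have SE x : S x = \sum_(i < n | D i) v i / phi * Y i x.
  have -> : S x = phi^-1 * \sum_(i < n | D i) v i * Y i x.
    by rewrite /= /S0 /Z; field; rewrite !gt_eqF.
  by rewrite mulr_sumr; apply: eq_bigr => i _; rewrite mulrA [phi^-1 * _]mulrC.
have [C' [HC' st1 st2]] := edf_sum_law it Dj0 SE.
have FE y : EDF_F kappa Theta t V phi y = C' `]-oo, y * (V / phi)]%classic.
  rewrite /EDF_F (EDF_lawof_nat V0 it HC')//; congr (C' _).
  by apply/seteqP; split => x /=; rewrite !in_itv/= ler_pdivrMr.
have FsE y : EDF_Fs kappa Theta t V phi y = C' `]-oo, y * (V / phi)[%classic.
  rewrite /EDF_Fs (EDF_lawof_nat V0 it HC')//; congr (C' _).
  by apply/seteqP; split => x /=; rewrite !in_itv/= ltr_pdivrMr.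
have mSA (U : set R) : measurable U -> measurable (S @^-1` U).
  by move=> mU; rewrite -[X in measurable X]setTI; exact: (mS measurableT U mU).
split=> // h.
- pose U := [set u | (C' `]-oo, u]%classic < delta%:E)%E].
  have dU : down_closed U.
    move=> x y xy; apply: le_lt_trans; apply: le_measure; rewrite ?inE//.
    by move=> z /=; rewrite !in_itv/= => /le_trans; apply.
  have mU := down_closed_measurable dU.
  have -> : A = S @^-1` U by apply/seteqP; split => x; rewrite /A /U /= FE.
  split; first exact: mSA.
  apply: (@le_trans _ _ (C' U)).
    exact: (stle_down_closed (st1 h) dU).
  by apply: down_closed_le => // u /ltW.
- pose U := [set u | ((1 - delta)%:E < C' `]-oo, u[%classic)%E].
  have dU : down_closed (~` U).
    move=> x y xy Uy Ux; apply: Uy; apply: (lt_le_trans Ux).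
    apply: le_measure; rewrite ?inE//.
    by move=> z /=; rewrite !in_itv/= => /lt_le_trans; apply.
  have mCU := down_closed_measurable dU.
  have mU : measurable U by rewrite -[U]setCK; exact: measurableC.
  have -> : B = S @^-1` U by apply/seteqP; split => x; rewrite /B /U /= FsE.
  split; first exact: mSA.
  apply: (@le_trans _ _ (C' U)).
    have := stle_down_closed (st2 h) dU.
    rewrite (probability_setC C' mU) [leRHS](probability_setC (distribution P S) mU).
    have fa : C' U \is a fin_num by exact: fin_num_measure.
    have fb : distribution P S U \is a fin_num by apply: fin_num_measure.
    rewrite -[X in (_ <= 1 - X -> X <= _)%E]/(distribution P S U).
    by rewrite -(fineK fa) -(fineK fb) -!EFinB !lee_fin; lra.
  apply: up_closed_le => // u Uu.
  rewrite -setCitvl probability_setC// leeBlDr ?fin_num_measure//.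
  by rewrite -leeBlDl// -EFinB ltW.
Qed.

End law_of_edf.

Lemma measure_bigsetU_le d (T : measurableType d) (R : realType)
    (mu : {measure set T -> \bar R}) (I : eqType) (r : seq I) (F : I -> set T) (c : R) :
  {in r, forall i, measurable (F i) /\ (mu (F i) <= c%:E)%E} ->
  measurable (\big[setU/set0]_(i <- r) F i) /\
  (mu (\big[setU/set0]_(i <- r) F i) <= ((size r)%:R * c)%:E)%E.
Proof.
elim: r => [|i r IH] h; first by rewrite big_nil measure0 mul0r.
have [m1 l1] := h i (mem_head _ _).
have [m2 l2] : _ := IH (fun k kr => h k (@mem_behead _ (i :: r) k kr)).
rewrite big_cons; split; first exact: measurableU.
rewrite (le_trans (measureU2 _ m1 m2))// -natr1 mulrDl mul1r addrC EFinD.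
exact: leeD.
Qed.

Unset Implicit Arguments.

Theorem theorem4p1 (R : realType) (kappa : R -> R) (Theta : set R) (phi : R)
    (d : measure_display) (T : measurableType d) (P : probability T R)
    (n : nat) (Y : 'I_n -> {RV P >-> R}) (theta v : 'I_n -> R)
    (J : {set 'I_n * 'I_n}) (alpha : R) :
  assumption_A1 kappa Theta ->
  0 < phi ->
  (forall i, 0 < v i) ->
  (forall i, Theta° (theta i)) ->
  (forall i j : 'I_n, (i <= j)%N -> theta i <= theta j) ->
  mutually_independent P (fun i => (Y i : T -> R)) ->
  (forall i, EDF_law kappa Theta (theta i) (v i) phi (distribution P (Y i))) ->
  (forall p, p \in J -> (p.1 <= p.2)%N) ->
  0 < 1 - alpha < 1 ->
  let delta := alpha / (2 * #|J|%:R) in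
  ((1 - alpha)%:E <=
   P [set x | forall i : 'I_n,
        (Lbound kappa Theta phi theta v (fun i => (Y i : T -> R)) J delta i x
           <= 'E_P[Y i])%E /\
        ('E_P[Y i] <= Ubound kappa Theta phi theta v (fun i => (Y i : T -> R)) J delta i x)%E])%E.
Proof.
move=> A1 phi0 v0 itheta theta_nd indY lawY J_ord /andP[alpha1 alpha0]; cbv zeta.
set delta := alpha / (2 * #|J|%:R).
have a0 : 0 < alpha by lra.
have delta0 : 0 <= delta by rewrite /delta divr_ge0 ?mulr_ge0 ?(ltW a0).
have EY i : ('E_P[Y i] = (derive1 kappa (theta i))%:E)%E.
  exact: (EDF_expectation phi0 (v0 i) (itheta i) (lawY i)).
have kle i j : theta i <= theta j -> derive1 kappa (theta i) <= derive1 kappa (theta j).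
  exact: (derive1_kappa_le phi0 (v0 i) (itheta i) (itheta j) A1 (lawY i)).1.
have hE i : EDF_h kappa Theta (derive1 kappa (theta i)) = theta i.
  exact: (EDF_h_derive1 phi0 (v0 i) (itheta i) A1 (lawY i)).
have msp i : mean_space kappa Theta (derive1 kappa (theta i)) by exists (theta i).
set Y' := fun i => (Y i : T -> R).
pose V (p : 'I_n * 'I_n) := vsum v p.1 p.2.
pose Z p x := Zjk v Y' p.1 p.2 x.
pose A p := [set x | (EDF_F kappa Theta (theta p.1) (V p) phi (Z p x) < delta%:E)%E].
pose B p := [set x | ((1 - delta)%:E < EDF_Fs kappa Theta (theta p.2) (V p) phi (Z p x))%E].
have AB p : p \in J -> [/\ measurable_fun setT (Z p),
    measurable (A p) /\ (P (A p) <= delta%:E)%E & measurable (B p) /\ (P (B p) <= delta%:E)%E].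
  move=> pJ; have p12 := J_ord p pJ.
  pose D (i : 'I_n) := (p.1 <= i <= p.2)%N.
  have D1 : D p.1 by rewrite /D leqnn.
  have [mZ hA _] := edf_coverage phi0 v0 itheta indY lawY (D := D) (itheta p.1) D1 delta0.
  have [_ _ hB] := edf_coverage phi0 v0 itheta indY lawY (D := D) (itheta p.2) D1 delta0.
  split; [exact: mZ|apply: hA|apply: hB] => i /andP[h1 h2]; exact: theta_nd.
set E := [set x | _].
have LP i x : (Lbound kappa Theta phi theta v Y' J delta i x <= 'E_P[Y i])%E <->
    forall p, p \in J -> theta p.2 <= theta i ->
      (EDF_l kappa Theta delta (Z p x) (V p) phi <= 'E_P[Y i])%E.
  rewrite /Lbound; case: ifPn => [_|/existsPn nex]; split.
  - by move=> h p pJ pi; apply: le_trans h; apply: ereal_sup_ubound; exists p.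
  - by move=> h; apply: ge_ereal_sup => _ [p [pJ pi] <-]; exact: h.
  - by move=> _ p pJ pi; have := nex p; rewrite pJ pi.
  - by move=> _; rewrite EY; apply: ereal_inf_lbound; exists (theta i).
have UP i x : ('E_P[Y i] <= Ubound kappa Theta phi theta v Y' J delta i x)%E <->
    forall p, p \in J -> theta i <= theta p.1 ->
      ('E_P[Y i] <= EDF_u kappa Theta delta (Z p x) (V p) phi)%E.
  rewrite /Ubound; case: ifPn => [_|/existsPn nex]; split.
  - by move=> h p pJ pi; apply: (le_trans h); apply: ereal_inf_lbound; exists p.
  - by move=> h; apply: le_ereal_inf_tmp => _ [p [pJ pi] <-]; exact: h.
  - by move=> _ p pJ pi; have := nex p; rewrite pJ pi.
  - by move=> _; rewrite EY; apply: ereal_sup_ubound; exists (theta i).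
have mE : measurable E.
  have -> : E = \bigcap_(i in [set: 'I_n]) \bigcap_(p in [set: 'I_n * 'I_n])
      [set x | (p \in J -> theta p.2 <= theta i ->
          (EDF_l kappa Theta delta (Z p x) (V p) phi <= 'E_P[Y i])%E) /\
        (p \in J -> theta i <= theta p.1 ->
          ('E_P[Y i] <= EDF_u kappa Theta delta (Z p x) (V p) phi)%E)].
    apply/seteqP; split => x /=.
      move=> h i _ p _; have [/LP h1 /UP h2] := h i.
      by split => [pJ|pJ]; [exact: h1|exact: h2].
    by move=> h i; split; [apply/LP|apply/UP] => p pJ; have [h1 h2] := h i I p I; [exact: h1|exact: h2].
  have mcond (Q : Prop) (F : set T) : (Q -> measurable F) -> measurable [set x | Q -> F x].
    move=> mF; have [q|q] := pselect Q.
      by rewrite (_ : [set x | Q -> F x] = F); [exact: mF|apply/seteqP; split => x /=; [exact|]].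
    by rewrite (_ : [set x | Q -> F x] = setT)//; apply/seteqP; split => [x _ //|x _ /q].
  apply: fin_bigcap_measurable => // i _; apply: fin_bigcap_measurable => // p _.
  apply: measurableI; apply: (mcond) => pJ; apply: (mcond) => _.
    have [mZ _ _] := AB p pJ.
    pose D := [set y | (EDF_l kappa Theta delta y (V p) phi <= 'E_P[Y i])%E].
    have dD : down_closed D by move=> y y' yy'; apply: le_trans; exact: EDF_l_le.
    by have := mZ measurableT _ (down_closed_measurable dD); rewrite setTI.
  have [mZ _ _] := AB p pJ.
  pose D := [set y | ('E_P[Y i] <= EDF_u kappa Theta delta y (V p) phi)%E].
  have dD : down_closed (~` D).
    by move=> y y' yy' h k; apply: h; apply: (le_trans k); exact: EDF_u_le.
  have mD : measurable D by rewrite -[D]setCK; apply: measurableC; exact: down_closed_measurable.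
  by have := mZ measurableT _ mD; rewrite setTI.
have hbad : {in enum J, forall p, measurable (A p `|` B p) /\
    (P (A p `|` B p) <= (delta + delta)%:E)%E}.
  move=> p; rewrite mem_enum => /AB[_ [mA lA] [mB lB]]; split; first exact: measurableU.
  by rewrite (le_trans (measureU2 _ mA mB))// EFinD leeD.
have [mbad bad_le] := measure_bigsetU_le hbad.
set bad := \big[setU/set0]_(p <- enum J) (A p `|` B p) in mbad bad_le.
have Ebad : ~` bad `<=` E.
  move=> x xbad.
  have nAB p : p \in J -> ~ A p x /\ ~ B p x.
    move=> pJ; apply/not_orP => ABx; apply: xbad.
    by rewrite /bad -bigcup_seq; exists p => //=; rewrite mem_enum.
  move=> i; split; [apply/LP|apply/UP] => p pJ pi.
    have [_ nB] := nAB p pJ; apply: (@le_trans _ _ (derive1 kappa (theta p.2))%:E).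
      apply: ereal_inf_lbound; exists (derive1 kappa (theta p.2)) => //; split=> //.
      by rewrite hE leNgt; apply/negP.
    by rewrite EY lee_fin; exact: kle.
  have [nA _] := nAB p pJ; apply: (@le_trans _ _ (derive1 kappa (theta p.1))%:E).
    by rewrite EY lee_fin; exact: kle.
  apply: ereal_sup_ubound; exists (derive1 kappa (theta p.1)) => //; split=> //.
  by rewrite hE leNgt; apply/negP.
have le_alpha : (size (enum J))%:R * (delta + delta) <= alpha.
  rewrite -cardE; have [->|J0] := eqVneq #|J| 0%N; first by rewrite mul0r ltW.
  rewrite /delta; have J0' : #|J|%:R != 0 :> R by rewrite pnatr_eq0.
  rewrite le_eqVlt; apply/orP; left; apply/eqP; field; exact: J0'.
apply: (@le_trans _ _ (P (~` bad))).
  rewrite probability_setC// EFinB; apply: leeB => //.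
  by apply: (le_trans bad_le); rewrite lee_fin.
by apply: le_measure => //; rewrite inE//; exact: measurableC.
Qed.
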